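(* For $r=1,2$ let $\phi_r\in L^2(0,\infty)\cap\mathcal W$ with $\phi_r(x)>0$ for all $x\ge0$, and let $G_r$ be associated with $\phi_r$ as in the context. Suppose there is a constant $c>0$ such that $$c^{-1}\le\frac{\phi_2(x)}{\phi_1(x)}\le c\qquad\text{for all }x\ge0.$$ Then $G_1$ is a bounded operator on $L^2(0,\infty)$ if and only if $G_2$ is bounded. Moreover $G_1$ is compact if and only if $G_2$ is compact. If this holds (i.e. both are compact) and $\mu_{r,n}$, $n=1,2,\ldots$, are the eigenvalues of $G_r$ written in decreasing order and repeated according to multiplicity, then $$c^{-4}\mu_{1,n}\le\mu_{2,n}\le c^4\mu_{1,n}$$ for all $n$.
   Context: $\mathcal W=W^{1,2}_{\rm loc}[0,\infty)$ is the set of continuous functions $f$ on $[0,\infty)$ for which there is $g\in L^2_{\rm loc}[0,\infty)$ (that is, $g\in L^2(0,a)$ for every $a>0$) with $f(x)=f(0)+\int_0^x g(s)\,ds$ for all $x\ge0$. For $r=1,2$ put $$\psi_r(x)=\phi_r(x)\int_0^x\frac{ds}{\phi_r(s)^2},\qquad G_r(x,y)=\begin{cases}\psi_r(x)\phi_r(y)&0\le x\le y<\infty,\\ \phi_r(x)\psi_r(y)&0\le y\le x<\infty,\end{cases}$$ and $(G_rf)(x)=\int_0^\infty G_r(x,y)f(y)\,dy$. ''$G_r$ is bounded'' (resp. compact) means that this formula defines a bounded (resp. compact) operator on the Hilbert space $L^2(0,\infty)$. When $G_r$ is bounded it is known to be self-adjoint and non-negative with $\mathrm{Ker}(G_r)=0$.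 *)

(* Defs.v *)
From HB Require Import structures.
From mathcomp Require Import all_boot all_order all_algebra.
From mathcomp Require Import all_classical all_reals all_analysis.
Set Implicit Arguments.
Unset Strict Implicit.
Unset Printing Implicit Defensive.
Import Order.TTheory GRing.Theory Num.Theory.
Import numFieldNormedType.Exports.
Local Open Scope classical_set_scope.
Local Open Scope ring_scope.

Section defs.
Context {R : realType}.
Local Notation mu := (@lebesgue_measure R).
Implicit Types (D : set R) (f g phi : R -> R) (K : R -> R -> R).
Implicit Types (T : (R -> R) -> (R -> R)) (V : set (R -> R)).

(* A function on D is represented by any total function; its values outside D
   are irrelevant. Elements of L^2(D) are real-valued representatives, so
   equality in L^2(D) is equality almost everywhere on D. *)
Definition L2 D f : Prop := f \_ D \in Lfun mu 2%:E.

Definition L2norm D f : \bar R := ('N[mu]_2%:E [EFin \o (f \_ D)])%E.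

Definition half_line : set R := `]0, +oo[.

Definition W12loc f : Prop :=
  {within `[0, +oo[, continuous f} /\
  exists g, (forall a, 0 < a -> L2 `]0, a[ g) /\
    forall x, 0 <= x -> f x = f 0 + \int[mu]_(s in `[0, x]) g s.

Definition psi phi (x : R) : R :=
  phi x * \int[mu]_(s in `[0, x]) (phi s ^- 2).

Definition Gker phi (x y : R) : R :=
  if x <= y then psi phi x * phi y else phi x * psi phi y.

Definition int_op K f (x : R) : R := \int[mu]_(y in half_line) (K x y * f y).

(* The integrability clause makes the defining integral meaningful: the
   library's integral also has a value when the integrand is not integrable. *)
Definition bounded_int_op K : Prop :=
  (forall f, L2 half_line f ->
     {ae mu, forall x, half_line x ->
        mu.-integrable half_line (fun y => (K x y * f y)%:E)}) /\
  exists C : R, forall f, L2 half_line f ->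
    L2 half_line (int_op K f) /\
    (L2norm half_line (int_op K f) <= C%:E * L2norm half_line f)%E.

(* Bounded sequences are mapped to sequences with a convergent subsequence. *)
Definition compact_int_op K : Prop :=
  bounded_int_op K /\
  forall (f_ : nat -> R -> R) (M : R),
    (forall n, L2 half_line (f_ n) /\ (L2norm half_line (f_ n) <= M%:E)%E) ->
    exists (k : nat -> nat) g,
      [/\ {homo k : m n / (m < n)%N},
          L2 half_line g &
          L2norm half_line (int_op K (f_ (k n)) \- g) @[n --> \oo] --> 0%E].

Definition eigenspace T (lambda : R) : set (R -> R) :=
  [set f | L2 half_line f /\
           ae_eq mu half_line (T f) (fun x => lambda * f x)].

(* V, taken modulo equality almost everywhere on the half-line, has a basis
   with k elements. *)
Definition has_dim V (k : nat) : Prop :=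
  exists e : 'I_k -> R -> R,
    [/\ forall i, V (e i),
        forall a : 'I_k -> R,
          ae_eq mu half_line (fun x => \sum_(i < k) a i * e i x) (cst 0) ->
          forall i, a i = 0 &
        forall f, V f -> exists a : 'I_k -> R,
          ae_eq mu half_line f (fun x => \sum_(i < k) a i * e i x)].

(* m 0, m 1, ... lists the eigenvalues of T in decreasing order, each repeated
   according to its multiplicity: every real lambda has finite multiplicity k
   (k = 0 when lambda is not an eigenvalue) and occurs exactly k times. *)
Definition eigenvalue_sequence T (m : nat -> R) : Prop :=
  nonincreasing_seq m /\
  forall lambda : R, exists k : nat,
    has_dim (eigenspace T lambda) k /\ ([set n | m n = lambda] #= `I_k)%card.

End defs.

(* Main.v *)
Require Import Defs.
From HB Require Import structures.
From mathcomp Require Import all_boot all_order all_algebra ring lra.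
From mathcomp Require Import all_classical all_reals all_analysis.
From mathcomp Require Import measurable_realfun.
Set Implicit Arguments.
Unset Strict Implicit.
Unset Printing Implicit Defensive.
Import Order.TTheory GRing.Theory Num.Theory.
Import numFieldNormedType.Exports.
Local Open Scope classical_set_scope.
Local Open Scope ring_scope.

(** Write [u = phi_r f] and let [U] be the tail integral of [u].  The kernel of
    [G_r] is [phi_r(x) phi_r(y)] times the integral of [phi_r^-2] over
    [[0, min(x, y)]], so Fubini gives [<G_r f, g>] as the integral of
    [phi_r^-2 U V], where [V] is the tail integral of [phi_r g].  With [W] the
    multiplication by [phi_2 / phi_1], the functions [W f] (for [phi_1]) and [f]
    (for [phi_2]) have the same [U], hence
    [<G_2 f, f> <= c^2 <G_1 W f, W f>] while [|W f|^2 <= c^2 |f|^2]; the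
    eigenvalue bound follows by the min-max argument.  Boundedness is transferred
    by the pointwise bound [0 <= G_2(x, y) <= c^4 G_1(x, y)].  For compactness,
    the form inequality makes [<G_2 h, h>] small for differences [h] along a
    subsequence; [|G_2 h|^2] and, at each fixed [x], [(G_2 h)(x)^2] are bounded by
    multiples of [<G_2 h, h>], so the pointwise limit is also an L^2 limit by
    Fatou's lemma. *)

(** Pointwise domination of the kernels settles boundedness but gives no direct access to
    compactness or to the eigenvalues. For these the operators are compared as quadratic forms,
    whose tail integrals carry different functions [phi_r]. Inserting [W] moves this difference into
    the vector, so that only the weights [phi_r^-2] remain to be compared. The price is [c^2] for
    the weights and [c^2] for the squared norm of [W], hence the exponent 4. Neither a spectral
    theorem nor completeness of [L^2] is invoked. The min-max bound comes from the list of
    multiplicities alone: a Rayleigh quotient above the eigenvalue of index [n], on the complement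
    of the first [n] eigenvectors, would by compactness produce an eigenvector for which the list
    has no room. Limits are either supplied by the definition of compactness or built pointwise. *)

Lemma quadratic_form_disc (R : realType) (p q r : R) :
  (forall a b, 0 <= a ^+ 2 * p + 2 * a * b * q + b ^+ 2 * r) ->
  q ^+ 2 <= p * r.
Proof.
move=> h; have r0 : 0 <= r by have := h 0 1; lra.
have [{}r0|rN0] := eqVneq r 0.
  have [->|q0] := eqVneq q 0; first by rewrite r0 mulr0 expr0n.
  (* When [r = 0] the form at [(1, t)] is [p + 2 t q], and this [t] gives it the value [-1]. *)
  have := h 1 (- (p + 1) / (2 * q)); rewrite r0.
  set t := _ / _; have -> : 2 * 1 * t * q = - (p + 1) by rewrite /t; field.
  by lra.
have := h r (- q).
have -> : r ^+ 2 * p + 2 * r * - q * q + (- q) ^+ 2 * r = r * (p * r - q ^+ 2).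
  by ring.
by rewrite pmulr_rge0 ?subr_ge0// lt_neqAle eq_sym rN0.
Qed.

(** * Positive operators on a semi-inner product space *)

Section symmetric_forms.
Context {R : realType} {V : lmodType R}.
Implicit Types (B : V -> V -> R) (u v w : V).

Definition sym_form B : Prop :=
  (forall u v, B u v = B v u) /\
  (forall a u v w, B (a *: u + v) w = a * B u w + B v w).

Variable B : V -> V -> R.
Hypothesis HB : sym_form B.

Lemma formC u v : B u v = B v u. Proof. exact: HB.1. Qed.

Lemma formDl u v w : B (u + v) w = B u w + B v w.
Proof. by rewrite -{1}[u]scale1r HB.2 mul1r. Qed.

Lemma form0l w : B 0 w = 0.
Proof. by apply/(addrI (B 0 w)); rewrite -formDl !addr0. Qed.

Lemma formZl a u w : B (a *: u) w = a * B u w.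
Proof. by rewrite -{1}[a *: u]addr0 HB.2 form0l addr0. Qed.

Lemma formBl u v w : B (u - v) w = B u w - B v w.
Proof. by rewrite formDl -scaleN1r formZl mulN1r. Qed.

Lemma formDr u v w : B w (u + v) = B w u + B w v.
Proof. by rewrite !(formC w) formDl. Qed.

Lemma formZr a u w : B w (a *: u) = a * B w u.
Proof. by rewrite !(formC w) formZl. Qed.

Lemma formBr u v w : B w (u - v) = B w u - B w v.
Proof. by rewrite !(formC w) formBl. Qed.

Lemma form_suml I (r : seq I) (P : pred I) (F : I -> V) w :
  B (\sum_(i <- r | P i) F i) w = \sum_(i <- r | P i) B (F i) w.
Proof.
elim/big_rec2 : _ => [|i x y _ <-]; first by rewrite form0l.
by rewrite formDl.
Qed.

Lemma form_sumr I (r : seq I) (P : pred I) (F : I -> V) w :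
  B w (\sum_(i <- r | P i) F i) = \sum_(i <- r | P i) B w (F i).
Proof. by rewrite formC form_suml; under eq_bigr do rewrite formC. Qed.

Lemma formZ2 a u : B (a *: u) (a *: u) = a ^+ 2 * B u u.
Proof. by rewrite formZl formZr mulrA expr2. Qed.

(* Nonnegativity is only required on the plane spanned by u and v, since the
   forms below are only nonnegative on a subspace. *)
Lemma form_CauchySchwarz u v :
  (forall a b, 0 <= B (a *: u + b *: v) (a *: u + b *: v)) ->
  B u v ^+ 2 <= B u u * B v v.
Proof.
move=> B0; apply: quadratic_form_disc => a b; have := B0 a b.
rewrite formDl !formDr !formZl !formZr (formC v u).
by congr (_ <= _); ring.
Qed.

End symmetric_forms.

Section semi_inner_product.
Context {R : realType} {V : lmodType R}.
Variable ip : V -> V -> R.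
Hypothesis ipS : sym_form ip.
(* [ip] is only semi-definite: vectors count as equal when their difference [z]
   satisfies [ip z z = 0]. *)
Hypothesis ip0 : forall u, 0 <= ip u u.
Local Notation N u := (ip u u).
Implicit Types (u v w : V) (T : {linear V -> V}).

Lemma ip_CauchySchwarz u v : ip u v ^+ 2 <= N u * N v.
Proof. exact: form_CauchySchwarz. Qed.

(** Cauchy-Schwarz makes null vectors orthogonal to everything, so identities that hold only up to a
    null vector can be used inside [ip]. *)
Lemma ip_null u v : N u = 0 -> ip u v = 0.
Proof.
move=> u0; apply/eqP; rewrite -sqrf_eq0 eq_le sqr_ge0 andbT.
by have := ip_CauchySchwarz u v; rewrite u0 mul0r.
Qed.

Lemma sqnormD_le u v : N (u + v) <= 2 * N u + 2 * N v.
Proof.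
have := ip0 (u - v).
rewrite (formBl ipS) !(formBr ipS) (formDl ipS) !(formDr ipS).
by rewrite (formC ipS v u); lra.
Qed.

Lemma sqnormB u v : N (u - v) = N (v - u).
Proof.
rewrite -[u - v]opprB -[- (v - u)]scaleN1r.
by rewrite (formZ2 ipS) sqrrN expr1n mul1r.
Qed.

Record posop (K : R) T : Prop := {
  posop_ge0 : 0 <= K;
  posop_sym : forall u v, ip (T u) v = ip u (T v);
  posop_pos : forall u, 0 <= ip (T u) u;
  posop_bdd : forall u, N (T u) <= K ^+ 2 * N u }.

(** The limit [g] is part of the definition, so [V] never has to be complete. *)
Definition compactop T : Prop :=
  forall (u : nat -> V) M, (forall n, N (u n) <= M) ->
  exists (k : nat -> nat) g, {homo k : m n / (m < n)%N} /\
    forall eps, 0 < eps ->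
      exists n0, forall n, (n0 <= n)%N -> N (T (u (k n)) - g) < eps.

Section posop.
Variables (K : R) (T : {linear V -> V}).
Hypothesis TP : posop K T.

Lemma posop_form : sym_form (fun u v => ip (T u) v).
Proof.
split=> [u v|a u v w]; first by rewrite (posop_sym TP) (formC ipS).
by rewrite linearP ipS.2.
Qed.

Lemma posop_form_le u : ip (T u) u <= K * N u.
Proof.
rewrite -ler_sqr ?nnegrE ?(posop_pos TP)//; last first.
  by rewrite mulr_ge0 ?(posop_ge0 TP).
apply: (le_trans (ip_CauchySchwarz _ _)).
by rewrite exprMn expr2 mulrA ler_wpM2r// (posop_bdd TP).
Qed.

(** Cauchy-Schwarz for the form [<T u, v>] at [v = T u] bounds [|T u|^4] by
    [<T u, u> <T (T u), T u>], and the last factor is at most [K |T u|^2]. A small form value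
    therefore forces a small image. *)
Lemma posop_sqnorm_le u : N (T u) <= K * ip (T u) u.
Proof.
have [z0|z0] := eqVneq (N (T u)) 0.
  by rewrite z0 mulr_ge0 ?(posop_ge0 TP) ?(posop_pos TP).
have Tu0 : 0 < N (T u) by rewrite lt_neqAle eq_sym z0 ip0.
have := form_CauchySchwarz posop_form (u := u) (v := T u).
move=> /(_ (fun a b => posop_pos TP _)) /= h.
have := posop_form_le (T u).
have := posop_pos TP u => p0 le1.
rewrite -(ler_pM2r Tu0) -expr2; apply: (le_trans h).
by rewrite -mulrA mulrCA ler_wpM2l.
Qed.

Lemma posop_eigen_ge0 lambda u :
  N (T u - lambda *: u) = 0 -> N u != 0 -> 0 <= lambda.
Proof.
move=> /(ip_null u); rewrite (formBl ipS) (formZl ipS) => /eqP.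
rewrite subr_eq0 => /eqP e u0.
have := posop_pos TP u; rewrite e pmulr_lge0//.
by rewrite lt_neqAle eq_sym u0 ip0.
Qed.

Lemma posop_eigen_ip lambda u v :
  N (T u - lambda *: u) = 0 -> ip (T u) v = lambda * ip u v.
Proof.
move=> /(ip_null v); rewrite (formBl ipS) (formZl ipS) => /eqP.
by rewrite subr_eq0 => /eqP.
Qed.

Lemma posop_eigen_orth alpha beta u v : alpha != beta ->
  N (T u - alpha *: u) = 0 -> N (T v - beta *: v) = 0 -> ip u v = 0.
Proof.
move=> ab Tu Tv; have := posop_eigen_ip v Tu.
rewrite (posop_sym TP) (formC ipS) (posop_eigen_ip u Tv) (formC ipS v u).
move=> /eqP; rewrite -subr_eq0 -mulrBl mulf_eq0 subr_eq0 eq_sym (negbTE ab)/=.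
by move=> /eqP.
Qed.

(* Almost maximizers of the Rayleigh quotient on the orthogonal complement of
   the [e i] are almost eigenvectors; compactness extracts a limit. *)
Lemma top_eigen n (e : nat -> V) (m : nat -> R) (kappa : R) h0 :
  compactop T -> (forall i, N (T (e i) - m i *: e i) = 0) ->
  0 <= kappa -> (forall i, (i < n)%N -> ip h0 (e i) = 0) ->
  kappa * N h0 < ip (T h0) h0 ->
  exists lambda g, [/\ kappa < lambda, forall i, (i < n)%N -> ip g (e i) = 0,
    N g != 0 & N (T g - lambda *: g) = 0].
Proof.
move=> Tc eE k0 h0e h0k.
pose P u := forall i, (i < n)%N -> ip u (e i) = 0.
have PD a b u v : P u -> P v -> P (a *: u + b *: v).
  move=> Pu Pv i ni.
  by rewrite (formDl ipS) !(formZl ipS) Pu// Pv// !mulr0 addr0.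
have PT u : P u -> P (T u).
  move=> Pu i ni; rewrite (posop_sym TP) (formC ipS) (posop_eigen_ip _ (eE i)).
  by rewrite (formC ipS) Pu// mulr0.
pose A := [set x : R | exists2 h, P h /\ N h = 1 & x = ip (T h) h].
have normalize u : P u -> N u != 0 ->
    A ((N u)^-1 * ip (T u) u).
  move=> Pu u0; have up : 0 < N u by rewrite lt_neqAle eq_sym u0 ip0.
  have s2 : (Num.sqrt (N u))^-1 ^+ 2 = (N u)^-1 by rewrite exprVn sqr_sqrtr.
  exists ((Num.sqrt (N u))^-1 *: u).
    split; last by rewrite (formZ2 ipS) s2 mulVf.
    by rewrite -[X in P X]addr0 -(scale0r u); exact: PD.
  by rewrite linearZ/= (formZl ipS) (formZr ipS) mulrA -expr2 s2.
have h00 : N h0 != 0.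
  apply/eqP => h00; move: h0k; rewrite h00 mulr0 (formC ipS) (ip_null _ h00).
  by rewrite ltxx.
have Asup : has_sup A.
  split; first by exists ((N h0)^-1 * ip (T h0) h0); exact: normalize.
  exists K => _ [h [_ h1] ->]; have := posop_form_le h.
  by rewrite h1 mulr1.
pose lambda := sup A.
have klam : kappa < lambda.
  apply: (@lt_le_trans _ _ ((N h0)^-1 * ip (T h0) h0)).
    by rewrite mulrC ltr_pdivlMr// lt_neqAle eq_sym h00 ip0.
  by apply: ub_le_sup; [exact: Asup.2|exact: normalize].
have lam0 : 0 < lambda by exact: le_lt_trans klam.
have lamP u : P u -> ip (T u) u <= lambda * N u.
  move=> Pu; have [u0|u0] := eqVneq (N u) 0.
    by rewrite (formC ipS) (ip_null _ u0) u0 mulr0.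
  rewrite mulrC -ler_pdivrMl; last by rewrite lt_neqAle eq_sym u0 ip0.
  by apply: ub_le_sup; [exact: Asup.2|exact: normalize].
(* The form of [lambda - T] is known to be non-negative only on [P], where [lambda] is the supremum
   of the Rayleigh quotients. *)
pose B u v := lambda * ip u v - ip (T u) v.
have BS : sym_form B.
  split=> [u v|a u v w]; rewrite /B.
    by rewrite (formC ipS) (formC posop_form).
  by rewrite ipS.2 (posop_form.2) /=; ring.
(* Cauchy-Schwarz for [B] at [u] and [r = (lambda - T) u] gives [|r|^4 <= B u u * B r r]. Here
   [B r r <= lambda |r|^2] as [T] is non-negative, and [B u u] is the gap between the Rayleigh
   quotient and its supremum. *)
have resid u : P u -> N u = 1 ->
    N (lambda *: u - T u) <= lambda * (lambda - ip (T u) u).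
  move=> Pu u1; set r := lambda *: u - T u.
  have Pr : P r by rewrite /r -scaleN1r; apply: PD => //; exact: PT.
  have := form_CauchySchwarz BS (u := u) (v := r).
  have BP a b : 0 <= B (a *: u + b *: r) (a *: u + b *: r).
    by rewrite subr_ge0 lamP//; exact: PD.
  move=> /(_ BP).
  have -> : B u r = N r by rewrite /B -(formZl ipS) -(formBl ipS).
  have -> : B u u = lambda - ip (T u) u by rewrite /B u1 mulr1.
  have Brr : B r r <= lambda * N r.
    by rewrite /B lerBlDr lerDl (posop_pos TP).
  have := lamP _ Pu; rewrite u1 mulr1 -subr_ge0 => d0 h.
  have [z0|z0] := eqVneq (N r) 0; first by rewrite z0 mulr_ge0// ltW.
  have rp : 0 < N r by rewrite lt_neqAle eq_sym z0 ip0.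
  rewrite -(ler_pM2r rp) -expr2; apply: (le_trans h).
  by rewrite -mulrA mulrCA ler_wpM2l.
(* A maximizing sequence with defect below [1 / (k + 1)]; [resid] turns it into a sequence of
   approximate eigenvectors. *)
have /choice[h hP] : forall k : nat, exists h, [/\ P h, N h = 1 &
    lambda - k.+1%:R^-1 < ip (T h) h].
  move=> k; have k1 : 0 < (k.+1%:R^-1 : R) by rewrite invr_gt0.
  have [_ [h [Ph h1] ->] hk] := sup_adherent k1 Asup.
  by exists h.
have [k [g [kmono kg]]] : exists (k : nat -> nat) g,
    {homo k : m n / (m < n)%N} /\ forall eps, 0 < eps ->
    exists n0, forall n, (n0 <= n)%N -> N (T (h (k n)) - g) < eps.
  by apply: (Tc h 1) => j; case: (hP j) => _ ->.
have kge j : (j <= k j)%N.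
  by elim: j => // j IH; exact: leq_ltn_trans (kmono _ _ (ltnSn j)).
have appr eps : 0 < eps -> exists u, [/\ P u, N u = 1,
    N (T u - g) < eps & N (lambda *: u - T u) < eps].
  move=> eps0; have [n0 n0P] := kg _ eps0.
  (* Beyond [n1] the bound of order [lambda / (k j + 1)] obtained from [resid] is below [eps]. *)
  have [n1 n1P] : exists n1 : nat, lambda / eps < n1%:R.
    by exists (Num.truncn (lambda / eps)).+1; rewrite truncnS_gt.
  pose j := maxn n0 n1.
  have [Pu u1 hu] := hP (k j); exists (h (k j)); split=> //.
    by apply: n0P; rewrite leq_maxl.
  apply: (le_lt_trans (resid _ Pu u1)).
  apply: (@le_lt_trans _ _ (lambda * (k j).+1%:R^-1)).
    rewrite ler_wpM2l//; first exact: ltW.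
    by move: hu; set x := _^-1; lra.
  rewrite ltr_pdivrMr// mulrC -ltr_pdivrMr//; apply: (lt_le_trans n1P).
  by rewrite ler_nat (leq_trans (leq_maxr n0 _))// (leq_trans (kge _)).
have appr' eps : 0 < eps -> exists u, [/\ P u, N u = 1,
    N (lambda *: u - g) < eps & N (T u - g) < eps].
  move=> eps0; have e4 : 0 < eps / 4 by lra.
  have [u [Pu u1 ug lu]] := appr _ e4; exists u; split=> //; last by lra.
  have -> : lambda *: u - g = (lambda *: u - T u) + (T u - g).
    by rewrite addrA subrK.
  by apply: (le_lt_trans (sqnormD_le _ _)); lra.
have small (x c : R) : 0 <= x -> 0 <= c ->
    (forall eps : R, 0 < eps -> x <= c * eps) -> x = 0.
  move=> x0 c0 xe; apply/eqP; rewrite eq_le x0 andbT leNgt; apply/negP => xp.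
  have := xe (x / (2 * (c + 1))); rewrite divr_gt0 ?mulr_gt0//; last by lra.
  move=> /(_ isT); rewrite mulrA ler_pdivlMr; last by nra.
  nra.
exists lambda, g; split=> //.
- move=> i ni; apply/eqP; rewrite -sqrf_eq0; apply/eqP.
  apply: (small _ (N (e i))) => // [|eps eps0]; first exact: sqr_ge0.
  have [u [Pu _ ug _]] := appr' _ eps0.
  have -> : ip g (e i) ^+ 2 = ip (lambda *: u - g) (e i) ^+ 2.
    by rewrite (formBl ipS) (formZl ipS) (Pu i ni) mulr0 sub0r sqrrN.
  apply: (le_trans (ip_CauchySchwarz _ _)); rewrite mulrC ler_wpM2l//.
  exact: ltW.
(* If [g] were null, [lambda^2 = |lambda u|^2] would be at most
   [2 |lambda u - g|^2 < lambda^2 / 2]. *)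
- apply/eqP => g0.
  have /appr'[u [_ u1 ug _]] : 0 < lambda ^+ 2 / 4.
    by rewrite divr_gt0// exprn_gt0.
  have := sqnormD_le (lambda *: u - g) g; rewrite subrK (formZ2 ipS) u1 g0.
  have := exprn_gt0 2 lam0.
  lra.
- apply: (small _ (2 * K ^+ 2 + 2 * lambda ^+ 2)) => // [|eps eps0].
    by have := sqr_ge0 K; have := sqr_ge0 lambda; lra.
  have [u [_ _ ug Tug]] := appr' _ eps0.
  have -> : T g - lambda *: g = T (g - lambda *: u) + lambda *: (T u - g).
    have -> : T (g - lambda *: u) = T g - lambda *: T u.
      by rewrite linearB linearZ.
    by rewrite [in RHS]scalerBr [RHS]addrA subrK.
  apply: (le_trans (sqnormD_le _ _)); rewrite (formZ2 ipS).
  have := posop_bdd TP (g - lambda *: u); rewrite sqnormB => h1.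
  have := sqr_ge0 K; have := sqr_ge0 lambda; nra.
Qed.

End posop.
End semi_inner_product.

(** * Eigenvalue lists and the min-max comparison *)

Section minimax.
Context {R : realType} {V : lmodType R}.
Variable ip : V -> V -> R.
Hypothesis ipS : sym_form ip.
Hypothesis ip0 : forall u, 0 <= ip u u.
Local Notation N u := (ip u u).
Implicit Types (u v w : V) (T : {linear V -> V}).

(** The abstract form of [eigenvalue_sequence]: equality almost everywhere becomes a difference of
    norm zero. *)
Definition eigenseq T (m : nat -> R) : Prop :=
  {homo m : i j / (i <= j)%N >-> j <= i} /\
  forall lambda : R, exists k : nat,
    (exists e : 'I_k -> V,
      [/\ forall i, N (T (e i) - lambda *: e i) = 0,
          forall a : 'I_k -> R, N (\sum_i a i *: e i) = 0 -> forall i, a i = 0 &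
          forall f, N (T f - lambda *: f) = 0 ->
            exists a : 'I_k -> R, N (f - \sum_i a i *: e i) = 0]) /\
    ([set n | m n = lambda] #= `I_k)%card.

(** The bijection between the positions of [lambda] in [m] and the index set of a basis of the
    eigenspace lets that basis be indexed by positions. Spanning is kept in the weaker form needed
    later: an eigenvector orthogonal to all listed ones is null. *)
Lemma eigenseq_eigenspace T m lambda : eigenseq T m ->
  exists s : nat -> V, [/\
    forall i, m i = lambda -> N (T (s i) - lambda *: s i) = 0,
    forall n (x : 'I_n -> R), (forall i : 'I_n, m i <> lambda -> x i = 0) ->
      N (\sum_i x i *: s i) = 0 -> forall i, x i = 0 &
    forall f, N (T f - lambda *: f) = 0 ->
      (forall j, m j = lambda -> ip f (s j) = 0) -> N f = 0].
Proof.
move=> [_ /(_ lambda)[k [[e [eE efree espan]] /card_set_bijP[sg]]]].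
move=> [sgfun sginj sgsurj].
have sglt i : m i = lambda -> (sg i < k)%N by move=> h; exact: sgfun.
(* The default 0 can occur only at positions [i] where [m i] differs from [lambda]. *)
pose s i : V := if insub (sg i) is Some j then e j else 0.
have sE i (h : m i = lambda) : s i = e (Ordinal (sglt i h)).
  rewrite /s; case: insubP => [j _ ji|]; last by rewrite sglt.
  by congr e; exact: val_inj.
exists s; split.
- by move=> i h; rewrite (sE _ h).
- move=> n x x0.
  have -> : \sum_i x i *: s i = \sum_(j < k)
      (\sum_(i < n | sg i == j) x i) *: e j.
    under [RHS]eq_bigr do rewrite scaler_suml.
    rewrite (exchange_big_dep predT)//=; apply: eq_bigr => i _.
    have [h|h] := eqVneq (m i) lambda; last first.
      rewrite x0; last exact/eqP.
      by rewrite scale0r big1// => j _; rewrite scale0r.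
    rewrite (sE _ h) (bigD1 (Ordinal (sglt _ h)))//= big1 ?addr0// => j.
    by move=> /andP[/eqP ij]; rewrite -val_eqE/= ij eqxx.
  move=> /efree h i; have [mi|mi] := eqVneq (m i) lambda; last exact/x0/eqP.
  have := h (Ordinal (sglt _ mi)); rewrite /= (bigD1 i)//= big1 ?addr0//.
  move=> j /andP[/eqP sgij ji].
  have [mj|mj] := eqVneq (m j) lambda; last exact/x0/eqP.
  have : val j = val i by apply: sginj; rewrite ?inE.
  by move=> /val_inj ij; rewrite ij eqxx in ji.
- move=> f /espan[a fa] fs.
  have fe j : ip f (e j) = 0.
    have [i /= mi sgi] := sgsurj j (ltn_ord j).
    by rewrite -(fs _ mi) (sE _ mi); congr (ip f (e _)); exact: val_inj.
  have -> : N f = ip (f - \sum_i a i *: e i) f.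
    rewrite (formBl ipS) (form_suml ipS) big1 ?subr0// => i _.
    by rewrite (formZl ipS) (formC ipS) fe mulr0.
  exact: ip_null.
Qed.

(** Choosing a family for every real [lambda] and reading at position [i] the family of [m i] yields
    one sequence of eigenvectors matched to [m]. *)
Lemma eigenseq_basis K T m : posop ip K T -> eigenseq T m ->
  exists e : nat -> V, [/\
    forall i, N (T (e i) - m i *: e i) = 0,
    forall n (x : 'I_n -> R), N (\sum_i x i *: e i) = 0 -> forall i, x i = 0 &
    forall lambda f, N (T f - lambda *: f) = 0 ->
      (forall j, m j = lambda -> ip f (e j) = 0) -> N f = 0].
Proof.
move=> TP mE.
have /choice[s sP] := fun lambda => @eigenseq_eigenspace T m lambda mE.
have eE i : N (T (s (m i) i) - m i *: s (m i) i) = 0.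
  by have [+ _ _] := sP (m i); exact.
exists (fun i => s (m i) i); split=> //; last first.
  move=> lambda f fE fs; have [_ _ h] := sP lambda; apply: (h f fE) => j mj.
  by rewrite -(fs _ mj) mj.
move=> n x x0 i.
(* [y] keeps the coefficients belonging to the eigenvalue [m i]. Distinct eigenspaces are
   orthogonal, so pairing this part with an eigenvector for [m i] is the same as pairing the whole
   combination, which is null. *)
pose y (j : 'I_n) : R := if m j == m i then x j else 0.
have -> : x i = y i by rewrite /y eqxx.
have [_ + _] := sP (m i); apply; first by move=> j /eqP/negbTE; rewrite /y => ->.
set g := \sum_i _.
have gE : g = \sum_(j < n | m j == m i) x j *: s (m j) j.
  rewrite /g [RHS]big_mkcond/=; apply: eq_bigr => j _.
  by rewrite /y; case: eqP => [->//|_]; rewrite scale0r.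
have -> : N g = ip g (\sum_(j < n | m j == m i) x j *: s (m j) j).
  by rewrite -gE.
rewrite (form_sumr ipS) big1// => j /eqP mji; rewrite (formZr ipS).
suff -> : ip g (s (m j) j) = 0 by rewrite mulr0.
rewrite -[RHS](ip_null ipS ip0 (s (m j) j) x0) gE !(form_suml ipS).
rewrite big_mkcond/=; apply: eq_bigr => l _; case: eqP => // /eqP ml.
rewrite (formZl ipS) (posop_eigen_orth ipS ip0 TP _ (eE l) (eE j)) ?mulr0//.
by rewrite mji.
Qed.

Lemma eigen_sum_form_ge K T (e : nat -> V) (m : nat -> R) n (x : 'I_n.+1 -> R) :
  posop ip K T -> {homo m : i j / (i <= j)%N >-> j <= i} ->
  (forall i, N (T (e i) - m i *: e i) = 0) ->
  m n * N (\sum_i x i *: e i) <= ip (T (\sum_i x i *: e i)) (\sum_i x i *: e i).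
Proof.
move=> TP mhomo eE; set f := \sum_i x i *: e i.
(* Eigenvectors for distinct eigenvalues are orthogonal, so the difference is
   the squared norm of \sum_i sqrt (m i - m n) x_i e_i. *)
pose s (i : 'I_n.+1) := Num.sqrt (m i - m n).
have mi (i : 'I_n.+1) : 0 <= m i - m n by rewrite subr_ge0 mhomo// -ltnS.
rewrite -subr_ge0.
suff -> : ip (T f) f - m n * N f = N (\sum_i (s i * x i) *: e i) by [].
rewrite -(formZl ipS) -(formBl ipS) /f linear_sum scaler_sumr -sumrB.
rewrite !(form_suml ipS); apply: eq_bigr => i _.
rewrite !(form_sumr ipS); apply: eq_bigr => j _.
rewrite !(formZr ipS) !(formBl ipS) !(formZl ipS) linearZ/= (formZl ipS).
rewrite (posop_eigen_ip ipS ip0 _ (eE i)).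
have [mij|mij] := eqVneq (m i) (m j); last first.
  by rewrite (posop_eigen_orth ipS ip0 TP mij) ?eE// !mulr0 subrr mulr0.
have -> : s j = s i by rewrite /s mij.
have := sqr_sqrtr (mi i); rewrite -/(s i) => si.
by transitivity (x i * x j * (m i - m n) * ip (e i) (e j)); [|rewrite -si]; ring.
Qed.

(** A matrix with [n + 1] rows and [n] columns has rank at most [n], hence a nonzero left kernel. *)
Lemma exists_orthogonal_combination n (M : 'I_n.+1 -> 'I_n -> R) :
  exists x : 'I_n.+1 -> R, (exists i, x i <> 0) /\
    forall j, \sum_i x i * M i j = 0.
Proof.
pose A : 'M[R]_(n.+1, n) := \matrix_(i, j) M i j.
have : kermx A != 0.
  rewrite kermx_eq0 /row_free neq_ltn; apply/orP; left.
  by rewrite ltnS rank_leq_col.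
move=> /rowV0Pn[v /sub_kermxP vA v0].
exists (fun i => v 0 i); split.
  move/eqP: v0; apply: contra_notP => h; apply/rowP => i; rewrite mxE.
  by apply: contra_notP h => h; exists i.
move=> j; have := congr1 (fun B : 'rV_n => B 0 j) vA.
rewrite !mxE => h; rewrite -[RHS]h.
by apply: eq_bigr => i _; rewrite mxE.
Qed.

(** By a dimension count some non-null [f] in the span of the first [n + 1] eigenvectors of [T2] has
    [W f] orthogonal to the first [n] of [T1]. Then [m2 n |f|^2 <= <T2 f, f> <= a <T1 W f, W f> <= a
    m1 n |W f|^2 <= a b m1 n |f|^2]. *)
Lemma eigen_le K1 K2 (T1 T2 W : {linear V -> V}) a b m1 m2 n :
  posop ip K1 T1 -> posop ip K2 T2 -> compactop ip T1 ->
  0 <= a -> 0 <= b ->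
  (forall u, ip (T2 u) u <= a * ip (T1 (W u)) (W u)) ->
  (forall u, N (W u) <= b * N u) ->
  eigenseq T1 m1 -> eigenseq T2 m2 -> m2 n <= a * b * m1 n.
Proof.
move=> P1 P2 C1 a0 b0 le21 leW E1 E2.
have [e1 [e1E e1free e1max]] := eigenseq_basis P1 E1.
have [e2 [e2E e2free _]] := eigenseq_basis P2 E2.
(* An eigenvalue of a non-negative operator; that [e1 n] is not null follows from freeness applied
   to the indicator of the last index. *)
have m1_ge0 : 0 <= m1 n.
  apply: (posop_eigen_ge0 ipS ip0 P1 (e1E n)); apply/eqP => e0.
  have := @e1free n.+1 (fun i => (i == ord_max)%:R) _ ord_max.
  rewrite eqxx (bigD1 ord_max)//= big1 ?addr0 ?eqxx ?scale1r//.
    by move=> /(_ e0)/eqP; rewrite oner_eq0.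
  by move=> i /negbTE ->; rewrite scale0r.
have [x [[i0 xi0] xorth]] :=
  exists_orthogonal_combination
    (fun (i : 'I_n.+1) (j : 'I_n) => ip (W (e2 i)) (e1 j)).
pose f := \sum_i x i *: e2 i.
have f0 : 0 < N f.
  rewrite lt_neqAle ip0 andbT eq_sym; apply/eqP => /e2free/(_ i0).
  exact: xi0.
have Wf i : (i < n)%N -> ip (W f) (e1 i) = 0.
  move=> ni; rewrite -[RHS](xorth (Ordinal ni)) /f linear_sum (form_suml ipS).
  by apply: eq_bigr => j _; rewrite linearZ/= (formZl ipS).
(* Otherwise [top_eigen] gives some [lambda > m1 n] with a non-null eigenvector orthogonal to the
   first [n]. Since [m1] is nonincreasing, every position of [lambda] is below [n], and [e1max]
   makes that eigenvector null. *)
have T1W : ip (T1 (W f)) (W f) <= m1 n * N (W f).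
  rewrite leNgt; apply/negP => h.
  have [lambda [g [lam ge1 g0 gE]]] := top_eigen ipS ip0 P1 C1 e1E m1_ge0 Wf h.
  apply/negP: g0; rewrite negbK; apply/eqP/(e1max lambda) => // j mj.
  apply: ge1; rewrite ltnNge; apply/negP => nj.
  by have := E1.1 _ _ nj; rewrite mj leNgt lam.
rewrite -(ler_pM2r f0).
apply: (le_trans (eigen_sum_form_ge x P2 E2.1 e2E)).
apply: (le_trans (le21 _)).
have -> : a * b * m1 n * N f = a * (m1 n * (b * N f)) by ring.
by rewrite ler_wpM2l//; apply: (le_trans T1W); rewrite ler_wpM2l.
Qed.

(** Compactness is applied to the bounded sequence [W (u n)]. For a difference [h],
    [<T1 W h, W h>^2 <= |T1 W h|^2 |W h|^2] has a small first factor and a bounded second one. *)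
Lemma compactop_form_cauchy K1 (T1 T2 W : {linear V -> V}) a b
    (u : nat -> V) M :
  posop ip K1 T1 -> compactop ip T1 -> 0 <= a -> 0 <= b ->
  (forall u, ip (T2 u) u <= a * ip (T1 (W u)) (W u)) ->
  (forall u, N (W u) <= b * N u) ->
  (forall n, N (u n) <= M) ->
  exists k : nat -> nat, {homo k : m n / (m < n)%N} /\
    forall eps, 0 < eps -> exists n0, forall n m, (n0 <= n)%N -> (n0 <= m)%N ->
      ip (T2 (u (k n) - u (k m))) (u (k n) - u (k m)) < eps.
Proof.
move=> P1 C1 a0 b0 le21 leW uM.
have [k [g [kmono kg]]] : exists (k : nat -> nat) g,
    {homo k : m n / (m < n)%N} /\ forall eps, 0 < eps ->
    exists n0, forall n, (n0 <= n)%N -> N (T1 (W (u (k n))) - g) < eps.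
  apply: (C1 (fun n => W (u n)) (b * M)) => n.
  by apply: (le_trans (leW _)); rewrite ler_wpM2l.
exists k; split=> // eps eps0.
have M0 : 0 <= M := le_trans (ip0 _) (uM 0%N).
(* With [|W h|^2 <= 4 b M] and [|T1 W h|^2 <= 4 eps^2 / c], the square of [a <T1 W h, W h>] is at
   most [(c - 1) / c * eps^2]; the summand 1 keeps [c] positive and the final bound strict. *)
pose c := a ^+ 2 * (4 * (b * (4 * M))) + 1.
have c0 : 0 < c by rewrite ltr_wpDl// !mulr_ge0// sqr_ge0.
have [] := kg (eps ^+ 2 / c); first by rewrite divr_gt0// exprn_gt0.
move=> n0 n0P; exists n0 => n m nn nm.
set h := u (k n) - u (k m).
have Nh : N h <= 4 * M.
  rewrite /h -[- u _]scaleN1r; apply: (le_trans (sqnormD_le ipS ip0 _ _)).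
  rewrite (formZ2 ipS) sqrrN expr1n mul1r.
  by have := uM (k n); have := uM (k m); lra.
have NW : N (W h) <= b * (4 * M).
  by apply: (le_trans (leW _)); rewrite ler_wpM2l.
have NT : N (T1 (W h)) <= 4 * (eps ^+ 2 / c).
  have -> : T1 (W h) = (T1 (W (u (k n))) - g) + (g - T1 (W (u (k m)))).
    by rewrite addrA subrK /h !linearB.
  apply: (le_trans (sqnormD_le ipS ip0 _ _)); rewrite (sqnormB ipS g).
  by have := n0P _ nn; have := n0P _ nm; lra.
apply: (le_lt_trans (le21 _)).
have [z0|z0] := ltP (a * ip (T1 (W h)) (W h)) 0; first exact: lt_trans eps0.
rewrite -ltr_sqr ?nnegrE//; last exact: ltW.
rewrite exprMn.
apply: (@le_lt_trans _ _ (a ^+ 2 * (4 * (eps ^+ 2 / c) * (b * (4 * M))))).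
  rewrite ler_wpM2l ?sqr_ge0//.
  apply: (le_trans (ip_CauchySchwarz ipS ip0 _ _)).
  by rewrite ler_pM.
have -> : a ^+ 2 * (4 * (eps ^+ 2 / c) * (b * (4 * M))) =
    (c - 1) / c * eps ^+ 2.
  by rewrite /c addrK; ring.
rewrite gtr_pMl ?exprn_gt0// ltr_pdivrMr// mul1r; lra.
Qed.

End minimax.

(** * The integral operators on the half-line *)

Section triangular_fubini.
Context {R : realType}.
Local Notation mu := (@lebesgue_measure R).
Implicit Types (v a : R -> R) (x s : R).

(** The ray starts at [-oo] because the integrands it is meant for are extended by 0 outside the
    half-line; Fubini is then applied on the whole plane. *)
Definition low_int a x : R := \int[mu]_(s in `]-oo, x]) a s.
Definition up_int v s : R := \int[mu]_(x in `[s, +oo[) v x.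

Let tri v a (z : R * R) : R := if z.2 <= z.1 then v z.1 * a z.2 else 0.

Let measurable_tri v a : measurable_fun setT v -> measurable_fun setT a ->
  measurable_fun setT (tri v a).
Proof.
move=> mv ma; apply: measurable_fun_ifT => //=.
  exact: measurable_fun_ler.
by apply: measurable_funM; exact: measurableT_comp.
Qed.

Let tri_abs v a z : `|tri v a z| = tri (fun x => `|v x|) (fun x => `|a x|) z.
Proof. by rewrite /tri; case: ifPn; rewrite ?normrM ?normr0. Qed.

Let tri_low v a x : mu.-integrable `]-oo, x] (EFin \o a) ->
  (\int[mu]_s (tri v a (x, s))%:E = (v x * low_int a x)%:E)%E.
Proof.
move=> ia; transitivity
    (\int[mu]_s (((fun s => (v x)%:E * (a s)%:E) \_ `]-oo, x]) s))%E.
  apply: eq_integral => s _; rewrite /tri/= patchE mem_setE in_itv/=.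
  by case: ifPn.
rewrite -integral_mkcond integralZl//= EFinM /low_int /Rintegral fineK//.
exact: integrable_fin_num.
Qed.

Let tri_up v a s : mu.-integrable `[s, +oo[ (EFin \o v) ->
  (\int[mu]_x (tri v a (x, s))%:E = (a s * up_int v s)%:E)%E.
Proof.
move=> iv; transitivity
    (\int[mu]_x (((fun x => (a s)%:E * (v x)%:E) \_ `[s, +oo[) x))%E.
  apply: eq_integral => x _; rewrite /tri/= patchE mem_setE in_itv/= andbT.
  by case: ifPn => //; rewrite mulrC.
rewrite -integral_mkcond integralZl//= EFinM /up_int /Rintegral fineK//.
exact: integrable_fin_num.
Qed.

(** The integral has a value even where [a] is not integrable, so Tonelli is applied separately to
    the positive and negative parts of [tri (cst 1) a], which is [a] cut off to [s <= x]. *)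
Lemma measurable_low_int a : measurable_fun setT a ->
  measurable_fun setT (low_int a).
Proof.
move=> ma; pose F z := (tri (cst 1) a z)%:E.
have mF : measurable_fun setT F.
  by apply/measurable_EFinP; exact: measurable_tri.
have -> : low_int a = fine \o ((fun x => \int[mu]_s (F ^\+)%E (x, s))%E \-
                               (fun x => \int[mu]_s (F ^\-)%E (x, s)))%E.
  apply/funext => x; rewrite /low_int Rintegral_mkcond /Rintegral /=.
  congr fine.
  transitivity (\int[mu]_s F (x, s))%E; last first.
    rewrite [LHS]integralE; congr (_ - _)%E; apply: eq_integral => ? _.
      by rewrite (funepos_comp F (fun s => (x, s))).
    by rewrite (funeneg_comp F (fun s => (x, s))).
  apply: eq_integral => s _; rewrite /F /tri /= patchE mem_setE in_itv/=.
  by case: ifPn => //; rewrite mul1r.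
apply: (measurableT_comp (@fine_measurable _ setT measurableT)).
by apply: emeasurable_funB; apply: measurable_fun_fubini_tonelli_F => //;
  [exact: measurable_funepos|exact: measurable_funeneg].
Qed.

Lemma measurable_up_int v : measurable_fun setT v ->
  measurable_fun setT (up_int v).
Proof.
move=> mv; pose F z := (tri v (cst 1) z)%:E.
have mF : measurable_fun setT F.
  by apply/measurable_EFinP; exact: measurable_tri.
have -> : up_int v = fine \o ((fun s => \int[mu]_x (F ^\+)%E (x, s))%E \-
                               (fun s => \int[mu]_x (F ^\-)%E (x, s)))%E.
  apply/funext => s; rewrite /up_int Rintegral_mkcond /Rintegral /=.
  congr fine.
  transitivity (\int[mu]_x F (x, s))%E; last first.
    rewrite [LHS]integralE; congr (_ - _)%E; apply: eq_integral => ? _.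
      by rewrite (funepos_comp F (fun x => (x, s))).
    by rewrite (funeneg_comp F (fun x => (x, s))).
  apply: eq_integral => x _; rewrite /F /tri /= patchE mem_setE in_itv/= andbT.
  by case: ifPn => //; rewrite mulr1.
apply: (measurableT_comp (@fine_measurable _ setT measurableT)).
by apply: emeasurable_funB; apply: measurable_fun_fubini_tonelli_G => //;
  [exact: measurable_funepos|exact: measurable_funeneg].
Qed.

(** The last hypothesis is the finiteness of one iterated integral of [|v x * a s|] over the
    triangle, so Tonelli makes the two-variable function integrable and Fubini exchanges the
    order. *)
Lemma triangular_fubini v a :
  (forall x, mu.-integrable `]-oo, x] (EFin \o a)) ->
  mu.-integrable setT (EFin \o v) -> measurable_fun setT a ->
  mu.-integrable setT (fun x => (`|v x| * low_int (fun s => `|a s|) x)%:E) ->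
  [/\ mu.-integrable setT (fun x => (v x * low_int a x)%:E),
      mu.-integrable setT (fun s => (a s * up_int v s)%:E) &
      \int[mu]_x (v x * low_int a x) = \int[mu]_s (a s * up_int v s)].
Proof.
move=> ia iv ma iva.
have mv : measurable_fun setT v.
  by apply/measurable_EFinP; exact: measurable_int iv.
have ivs s : mu.-integrable `[s, +oo[ (EFin \o v).
  by apply: integrableS iv.
have mF : measurable_fun setT (EFin \o tri v a).
  by apply/measurable_EFinP; exact: measurable_tri.
have iF : (mu \x mu)%E.-integrable setT (EFin \o tri v a).
  apply/integrable12ltyP => //.
  under eq_integral => x _.
    under eq_integral => s _ do rewrite /= tri_abs.
    rewrite tri_low; last exact: integrable_norm.
    over.
  move/integrableP : iva => [_]; congr (_ < _)%E.
  apply: eq_integral => x _; rewrite gee0_abs// lee_fin mulr_ge0//.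
  exact: Rintegral_ge0.
have FE : fubini_F mu (EFin \o tri v a) = fun x => (v x * low_int a x)%:E.
  by apply/funext => x; rewrite /fubini_F -tri_low.
have GE : fubini_G mu (EFin \o tri v a) = fun s => (a s * up_int v s)%:E.
  by apply/funext => s; rewrite /fubini_G -tri_up.
split.
- by rewrite -FE; exact: integrable_fubini_F.
- rewrite -GE; apply/integrableP; split; first exact: (measurable_fubini_G iF).
  have := iF; move=> /integrable21ltyP -/(_ mF); apply: le_lt_trans.
  apply: ge0_le_integral => //.
  + by apply: measurableT_comp => //; exact: (measurable_fubini_G iF).
  + have h : measurable_fun setT (fubini_G mu (abse \o (EFin \o tri v a))).
      apply: measurable_fun_fubini_tonelli_G => [|z]; last exact: abse_ge0.
      by apply: measurableT_comp mF.
    exact: h.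
  + move=> s _; apply: le_abse_integral => //.
    exact: (measurableT_comp mF).
- rewrite /Rintegral; congr fine.
  have := Fubini iF.
  rewrite -[LHS]/(\int[mu]_x (fubini_F mu (EFin \o tri v a)) x)%E FE.
  by rewrite -[RHS]/(\int[mu]_x (fubini_G mu (EFin \o tri v a)) x)%E GE.
Qed.

End triangular_fubini.

(** * Square integrable functions and their norm *)

Section square_integrable.
Context {R : realType}.
Local Notation mu := (@lebesgue_measure R).
(* [lebesgue_measure] is a measure on this alias of [R]; the lemmas on integrals
   do not unify it with the canonical measurable structure of [R]. *)
Local Notation lebesgueT := (g_sigma_algebraType R.-ocitv.-measurable).
Implicit Types (f g : R -> R) (D : set R).

Lemma Lfun2P f : f \in Lfun mu 2%:E <->
  measurable_fun setT f /\ mu.-integrable setT (fun x => (f x ^+ 2)%:E).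
Proof.
split=> [f2|[mf f2]].
  split; last exact: Lfun2_integrable_sqr.
  by move: f2; rewrite inE => /andP[/[!inE]].
rewrite inE; apply/andP; split; rewrite inE//=.
rewrite /finite_norm unlock poweR_lty//.
move/integrableP : f2 => [_]; congr (_ < _)%E; apply: eq_integral => x _ /=.
by rewrite powR_mulrn// normrX.
Qed.

Lemma integrable_patch D f : measurable D ->
  mu.-integrable D (EFin \o f) <-> mu.-integrable setT (EFin \o (f \_ D)).
Proof.
by move=> mD; rewrite -restrict_EFin; exact: (@integrable_mkcond _ _ R mu D).
Qed.

Lemma L2P D f : measurable D ->
  L2 D f <-> measurable_fun D f /\ mu.-integrable D (fun x => (f x ^+ 2)%:E).
Proof.
move=> mD.
have E : (fun x => ((f \_ D) x ^+ 2)%:E) = EFin \o ((fun x => f x ^+ 2) \_ D).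
  by apply/funext => x; rewrite /= !patchE; case: ifPn; rewrite // expr0n.
rewrite /L2 Lfun2P E; split=> -[mf f2]; split.
- exact/(measurable_restrictT f mD).
- exact/(integrable_patch _ mD).
- exact/(measurable_restrictT f mD).
- exact/(integrable_patch _ mD).
Qed.

Lemma L2normE D f : measurable D -> L2 D f ->
  L2norm D f = (Num.sqrt (\int[mu]_(x in D) (f x * f x)))%:E.
Proof.
move=> mD /(L2P _ mD)[mf f2].
have -> : \int[mu]_(x in D) (f x * f x) = \int[mu]_(x in D) (f x ^+ 2).
  by apply: eq_Rintegral => x _; rewrite expr2.
rewrite /L2norm unlock -powR12_sqrt; last first.
  by apply: Rintegral_ge0 => x _; exact: sqr_ge0.
rewrite -poweR_EFin /Rintegral fineK; last exact: integrable_fin_num.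
congr (_ `^ _)%E; rewrite [RHS]integral_mkcond; apply: eq_integral => x _ /=.
rewrite !patchE; case: ifPn => _; rewrite powR_mulrn ?normr0 ?expr0n//.
by rewrite real_normK ?num_real.
Qed.

Lemma integrable_L2M D f g : measurable D -> L2 D f -> L2 D g ->
  mu.-integrable D (fun x => (f x * g x)%:E).
Proof.
move=> mD f2 g2; apply/(integrable_patch (fun x => f x * g x) mD).
have /Lfun1_integrable := Lfun2_mul_Lfun1 f2 g2.
congr (_.-integrable _ _); apply/funext => x /=; rewrite !patchE.
by case: ifPn; rewrite // mulr0.
Qed.

Lemma L2_abs D f : measurable D -> L2 D f -> L2 D (fun x => `|f x|).
Proof.
move=> mD /(L2P _ mD)[mf f2]; apply/L2P => //; split; first exact: measurableT_comp.
by move: f2; apply: eq_integrable => // x _; rewrite real_normK ?num_real.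
Qed.

Lemma le_L2norm D f g a : measurable (D : set lebesgueT) ->
  measurable_fun D f -> L2 D g -> 0 <= a ->
  (forall x, D x -> `|f x| <= a * `|g x|) ->
  L2 D f /\ (L2norm D f <= a%:E * L2norm D g)%E.
Proof.
move=> mD mf g2 a0 fg.
have igg := integrable_L2M mD g2 g2.
have iagg := integrableZl mD (a ^+ 2) igg.
have fg2 x : D x -> f x * f x <= a ^+ 2 * (g x * g x).
  move=> Dx; rewrite -!expr2 -exprMn.
  rewrite -(real_normK (num_real (f x))) -(real_normK (num_real (a * g x))).
  by rewrite lerXn2r ?nnegrE// normrM (ger0_norm a0) fg.
have f2 : L2 D f.
  apply/L2P => //; split=> //; apply: le_integrable iagg => //.
    by apply/measurable_EFinP; exact: measurable_funX.
  move=> x Dx; rewrite /= lee_fin ger0_norm ?sqr_ge0// expr2.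
  exact: le_trans (fg2 _ Dx) (ler_norm _).
split=> //; rewrite !L2normE// -EFinM lee_fin.
rewrite -[X in X * _]ger0_norm// -sqrtr_sqr -sqrtrM ?sqr_ge0// ler_wsqrtr//.
rewrite -(RintegralZl _ mD igg); apply: le_Rintegral => //.
exact: integrable_L2M.
Qed.

End square_integrable.

(** * The kernel and its integral operator *)

Section kernel.
Context {R : realType}.
Local Notation mu := (@lebesgue_measure R).
Variable phi : R -> R.
Hypothesis phi_L2 : L2 half_line phi.
Hypothesis phi_cont : {within `[0, +oo[, continuous phi}.
Hypothesis phi_gt0 : forall x, 0 <= x -> 0 < phi x.
Implicit Types (f g : R -> R) (x y s : R).

Local Notation lebesgueT := (g_sigma_algebraType R.-ocitv.-measurable).

Lemma measurable_half_line : measurable (half_line : set lebesgueT).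
Proof. exact: measurable_itv. Qed.

Lemma measurable_ray x : measurable (`]-oo, x] : set lebesgueT).
Proof. exact: measurable_itv. Qed.
Hint Resolve measurable_half_line : core.

Lemma in_half_line x : (x \in half_line) = (0 < x).
Proof. by rewrite mem_setE in_itv/= andbT. Qed.

(** [phi] is controlled only on [[0, +oo[]. [phi0] and [dens] extend [phi] and [phi^-2] by 0, which
    makes them measurable on the whole line and lets integrals over rays see only the half-line. *)
Definition phi0 := phi \_ half_line.

Definition dens := (fun s => phi s ^- 2) \_ half_line.

Lemma phi0E x : phi0 x = if 0 < x then phi x else 0.
Proof. by rewrite /phi0 patchE in_half_line. Qed.

Lemma densE s : dens s = if 0 < s then phi s ^- 2 else 0.
Proof. by rewrite /dens patchE in_half_line. Qed.

Lemma phi0_ge0 x : 0 <= phi0 x.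
Proof. by rewrite phi0E; case: ifPn => // /ltW /phi_gt0 /ltW. Qed.

Lemma dens_ge0 s : 0 <= dens s.
Proof. by rewrite densE; case: ifPn => // _; rewrite invr_ge0 sqr_ge0. Qed.

Lemma measurable_phi0 : measurable_fun setT phi0.
Proof. by have /Lfun2P[] := phi_L2. Qed.

Lemma continuous_dens : {within `[0, +oo[, continuous (fun s => phi s ^- 2)}.
Proof.
apply/subspace_continuousP => x Ax; apply: cvgV.
  by rewrite sqrf_eq0 gt_eqF// phi_gt0//; move: Ax; rewrite /= in_itv/= andbT.
have /subspace_continuousP/(_ x Ax) h := phi_cont.
by under eq_fun do rewrite expr2; rewrite expr2; exact: cvgM.
Qed.

Lemma measurable_dens : measurable_fun setT dens.
Proof.
have h : measurable_fun (`[0, +oo[ : set R) (fun s => phi s ^- 2).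
  apply: subspace_continuous_measurable_fun; first exact: measurable_itv.
  exact: continuous_dens.
apply/(measurable_restrictT _ measurable_half_line); apply: measurable_funS h.
  exact: measurable_itv.
by move=> x; rewrite /half_line/= !in_itv/= !andbT => /ltW.
Qed.

Lemma integrable_phi_sqV x : mu.-integrable `[0, x] (fun s => (phi s ^- 2)%:E).
Proof.
apply: continuous_compact_integrable; first exact: segment_compact.
apply: continuous_subspaceW continuous_dens => y /=.
by rewrite !in_itv/= andbT => /andP[].
Qed.

Lemma integrable_dens x : mu.-integrable `]-oo, x] (EFin \o dens).
Proof.
rewrite /dens -restrict_EFin.
apply/(@integrable_restrict _ _ R mu _ measurable_half_line _ (measurable_ray x)).
apply: integrableS (integrable_phi_sqV x) => //; first exact: measurableI.
by move=> y [/=]; rewrite /half_line /= !in_itv/= andbT => -> /ltW ->.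
Qed.

(** The open half-line omits the point 0, a null set; the right-hand side is the integral in
    [psi]. *)
Lemma low_int_dens x : low_int dens x = \int[mu]_(s in `[0, x]) phi s ^- 2.
Proof.
rewrite /low_int /dens -Rintegral_mkcondr -[RHS]Rintegral_itv_obnd_cbnd.
  congr (\int[mu]_(s in _) _); apply/seteqP; split => y /=;
    rewrite /half_line/= !in_itv/= ?andbT; first by case=> -> ->.
  by move=> /andP[].
apply: integrableS (integrable_phi_sqV x) => //.
by move=> y /=; rewrite !in_itv/= => /andP[/ltW -> ->].
Qed.

Lemma low_int_dens_ge0 x : 0 <= low_int dens x.
Proof. by apply: Rintegral_ge0 => y _; exact: dens_ge0. Qed.

Lemma GkerE x y : 0 < x -> 0 < y ->
  Gker phi x y = phi x * phi y * low_int dens (Num.min x y).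
Proof.
move=> x0 y0; rewrite /Gker /psi !low_int_dens.
by case: leP => _; [rewrite mulrAC|rewrite mulrA].
Qed.

(** For fixed [x] this turns the dependence on the minimum into [low_int] of a single function, the
    shape that [triangular_fubini] accepts. *)
Lemma low_int_trunc a x y :
  low_int (a \_ `]-oo, x]) y = low_int a (Num.min x y).
Proof.
rewrite /low_int -Rintegral_mkcondr; congr (\int[mu]_(s in _) _).
apply/seteqP; split => s /=; rewrite !in_itv/= le_min; first by case=> -> ->.
by move=> /andP[].
Qed.

(* [int_op (Gker phi)] with the order of integration exchanged, and cut off to 0
   outside the half-line. *)
Definition Gop f x : R :=
  phi0 x * low_int (fun s => dens s * up_int (fun y => phi0 y * f y) s) x.

Lemma phi0M_patch f : (fun y => phi0 y * f y) = phi0 \* (f \_ half_line).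
Proof.
by apply/funext => y; rewrite /= /phi0 !patchE; case: ifPn; rewrite // !mul0r.
Qed.

Lemma integrable_phi0M f : L2 half_line f ->
  mu.-integrable setT (fun y => (phi0 y * f y)%:E).
Proof.
move=> f2; have /Lfun1_integrable := Lfun2_mul_Lfun1 phi_L2 f2.
by rewrite -phi0M_patch.
Qed.

Lemma measurable_phi0M f : L2 half_line f ->
  measurable_fun setT (fun y => phi0 y * f y).
Proof.
by move=> f2; apply/measurable_EFinP; exact: measurable_int (integrable_phi0M f2).
Qed.

Lemma low_int_dens_le x y : x <= y -> low_int dens x <= low_int dens y.
Proof.
move=> xy; rewrite -lee_fin /low_int /Rintegral !fineK; last 2 first.
- exact/integrable_fin_num/integrable_dens.
- exact/integrable_fin_num/integrable_dens.
apply: ge0_subset_integral => //=.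
- by apply/measurable_EFinP; apply: measurable_funTS; exact: measurable_dens.
- by move=> s _; rewrite lee_fin dens_ge0.
- by move=> s /=; rewrite !in_itv/= => /le_trans; exact.
Qed.

(** With [a] the density cut off at [x], the kernel as a function of [y] is
    [phi x * phi0 y * low_int a y] on the half-line, and the triangular exchange produces [Gop].
    Convergence holds at every [x > 0]: [phi0 * f] is integrable and [low_int a] is bounded by
    [low_int dens x]. *)
Lemma Gop_kernel f x : L2 half_line f -> 0 < x ->
  mu.-integrable half_line (fun y => (Gker phi x y * f y)%:E) /\
  int_op (Gker phi) f x = Gop f x.
Proof.
move=> f2 x0; pose u y := phi0 y * f y; pose a := dens \_ `]-oo, x].
have ia : mu.-integrable setT (EFin \o a).
  by apply/(integrable_patch _ (measurable_ray x)); exact: integrable_dens.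
have ma : measurable_fun setT a.
  by apply/measurable_EFinP; exact: measurable_int ia.
have iu : mu.-integrable setT (EFin \o u) by exact: integrable_phi0M.
have mu_ : measurable_fun setT u by exact: measurable_phi0M.
have absa : (fun s => `|a s|) = a.
  apply/funext => s; rewrite ger0_norm// /a patchE.
  by case: ifPn => // _; exact: dens_ge0.
have [] := @triangular_fubini R u a.
- by move=> y; apply: integrableS ia.
- by [].
- by [].
- rewrite absa; apply: (@le_integrable _ _ _ mu setT measurableT _
    (fun y => ((low_int dens x)%:E * (u y)%:E)%E)).
  + apply/measurable_EFinP; apply: measurable_funM; first exact: measurableT_comp.
    exact: measurable_low_int.
  + move=> y _; rewrite /= lee_fin /a low_int_trunc (normrM `|u y|) normr_id.
    rewrite [leRHS]normrM [leRHS]mulrC.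
    rewrite ler_wpM2l// !ger0_norm ?low_int_dens_ge0//.
    by apply: low_int_dens_le; rewrite ge_min lexx.
  + exact: integrableZl.
move=> iua _ uaE.
have E : (fun y => Gker phi x y * f y) \_ half_line =
    (fun y => phi x * (u y * low_int a y)).
  apply/funext => y; rewrite patchE in_half_line /u phi0E /a low_int_trunc.
  case: ifPn => y0; last by rewrite !mul0r mulr0.
  by rewrite GkerE//; ring.
split.
  apply/integrable_patch => //; rewrite E.
  exact: (integrableZl measurableT (phi x) iua).
rewrite /int_op Rintegral_mkcond E RintegralZl// /Gop phi0E x0 uaE.
congr (_ * _).
rewrite /low_int [RHS]Rintegral_mkcond; apply: eq_Rintegral => s _.
by rewrite /a !patchE; case: ifPn; rewrite // mul0r.
Qed.

Lemma Gop_patch f : L2 half_line f -> int_op (Gker phi) f \_ half_line = Gop f.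
Proof.
move=> f2; apply/funext => x; rewrite patchE in_half_line.
case: ifPn => x0; first by rewrite (Gop_kernel f2 x0).2.
by rewrite /Gop phi0E (negbTE x0) mul0r.
Qed.

Lemma L2_int_op f : L2 half_line f ->
  L2 half_line (int_op (Gker phi) f) <-> Gop f \in Lfun mu 2%:E.
Proof. by move=> f2; rewrite /L2 Gop_patch. Qed.

End kernel.

(** * Square integrable functions as a semi-inner product space *)

Section half_line_inner_product.
Context {R : realType}.
Local Notation mu := (@lebesgue_measure R).
Implicit Types (f g : R -> R).

(** Elements are functions on the whole line, not classes; [ip] sees only their restriction to the
    half-line, up to null sets, so it is only semi-definite. *)
Definition L2V : lmodType R := LfunType mu (lee1n 2).

Definition L2V_of f (f2 : L2 half_line f) : L2V := Lfun_Sub (lee1n 2) f2.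

Definition L2V_fun (u : L2V) : R -> R := (u : LfunType mu (lee1n 2)).

Definition ip (u v : L2V) : R :=
  \int[mu]_(x in half_line) (L2V_fun u x * L2V_fun v x).

Lemma L2V_ofE f (f2 : L2 half_line f) : L2V_fun (L2V_of f2) = f \_ half_line.
Proof. by []. Qed.

Lemma L2V_funD u v x : L2V_fun (u + v) x = L2V_fun u x + L2V_fun v x.
Proof. by []. Qed.

Lemma L2V_funZ a u x : L2V_fun (a *: u) x = a * L2V_fun u x.
Proof. by []. Qed.

Lemma L2V_funN u x : L2V_fun (- u) x = - L2V_fun u x.
Proof. by []. Qed.

Lemma L2V_fun_sum n (u : 'I_n -> L2V) x :
  L2V_fun (\sum_i u i) x = \sum_i L2V_fun (u i) x.
Proof.
elim/big_rec2 : _ => [//|i y v _ <-].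
by rewrite L2V_funD.
Qed.

Lemma L2V_inj u v : L2V_fun u =1 L2V_fun v -> u = v.
Proof. by move=> uv; apply/LfuneqP. Qed.

Lemma L2V_Lfun u : L2V_fun u \in Lfun mu 2%:E.
Proof. exact: LfunP. Qed.

Lemma L2V_L2 u : L2 half_line (L2V_fun u).
Proof.
have /Lfun2P[mu_ u2] := L2V_Lfun u.
apply/(L2P _ measurable_half_line); split; first exact: measurable_funTS.
by apply: integrableS u2 => //; exact: measurable_half_line.
Qed.

Lemma measurable_L2V_fun u : measurable_fun setT (L2V_fun u).
Proof. by have /Lfun2P[] := L2V_Lfun u. Qed.

Lemma integrable_L2V u v :
  mu.-integrable half_line (fun x => (L2V_fun u x * L2V_fun v x)%:E).
Proof. by apply: integrable_L2M; [exact: measurable_half_line|exact: L2V_L2..]. Qed.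

Lemma ip_form : sym_form ip.
Proof.
split=> [u v|a u v w].
  by apply: eq_Rintegral => x _; rewrite mulrC.
have mH := @measurable_half_line R.
have iau := integrableZl mH a (integrable_L2V u w).
transitivity (\int[mu]_(x in half_line)
    (a * (L2V_fun u x * L2V_fun w x) + L2V_fun v x * L2V_fun w x)).
  by apply: eq_Rintegral => x _; rewrite L2V_funD L2V_funZ; ring.
rewrite (RintegralD mH iau (integrable_L2V v w)).
by rewrite RintegralZl//; exact: integrable_L2V.
Qed.

Lemma ip_ge0 u : 0 <= ip u u.
Proof. by apply: Rintegral_ge0 => x _; rewrite -expr2 sqr_ge0. Qed.

Lemma ip_null_ae u : ip u u = 0 <-> ae_eq mu half_line (L2V_fun u) (cst 0).
Proof.
have E : (\int[mu]_(x in half_line) `|(L2V_fun u x * L2V_fun u x)%:E| =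
    (ip u u)%:E)%E.
  rewrite /ip /Rintegral fineK; last first.
    by apply: integrable_fin_num; [exact: measurable_half_line|exact: integrable_L2V].
  by apply: eq_integral => x _; rewrite gee0_abs// lee_fin -expr2 sqr_ge0.
have := @ae_eq_integral_abs _ _ _ mu _ measurable_half_line
  (fun x => (L2V_fun u x * L2V_fun u x)%:E) (measurable_int _ (integrable_L2V u u)).
rewrite E => h; split=> [u0|ae0].
  have : ae_eq mu half_line (fun x => (L2V_fun u x * L2V_fun u x)%:E) (cst 0%E).
    by apply/h; rewrite u0.
  apply: filterS => x /= h' /h'; rewrite -expr2 => -[/eqP].
  by rewrite sqrf_eq0 => /eqP.
apply: EFin_inj; apply/h; apply: filterS ae0 => x /= h' /h' ->.
by rewrite mul0r.
Qed.

Lemma L2norm_ip u : L2norm half_line (L2V_fun u) = (Num.sqrt (ip u u))%:E.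
Proof. by rewrite L2normE//; [exact: measurable_half_line|exact: L2V_L2]. Qed.

Lemma L2norm_L2V_of f (f2 : L2 half_line f) :
  L2norm half_line f = (Num.sqrt (ip (L2V_of f2) (L2V_of f2)))%:E.
Proof.
rewrite -L2norm_ip L2V_ofE /L2norm; congr ('N[mu]_2%:E[_])%E.
by apply/funext => x; rewrite /= !patchE; case: ifPn.
Qed.

Lemma eq_L2norm f g : {in half_line, f =1 g} ->
  L2norm half_line f = L2norm half_line g.
Proof.
move=> fg; rewrite /L2norm; congr ('N[mu]_2%:E[_])%E.
by apply/funext => x; rewrite /= !patchE; case: ifPn => // /fg ->.
Qed.

End half_line_inner_product.
Arguments L2V_fun : simpl never.

(** * The operator and the quadratic form of one weight *)

Section operator.
Context {R : realType}.
Local Notation mu := (@lebesgue_measure R).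
Variable phi : R -> R.
Hypothesis phi_L2 : L2 half_line phi.
Hypothesis phi_cont : {within `[0, +oo[, continuous phi}.
Hypothesis phi_gt0 : forall x, 0 <= x -> 0 < phi x.
Implicit Types (f g : R -> R) (x y s : R).
Local Notation G := (Gop phi).
Local Notation dens := (dens phi).
Local Notation phi0 := (phi0 phi).

Definition tail f : R -> R := up_int (fun y => phi0 y * f y).

Lemma measurable_tail f : L2 half_line f -> measurable_fun setT (tail f).
Proof. by move=> f2; apply: measurable_up_int; exact: measurable_phi0M. Qed.

Lemma measurable_Gop f : L2 half_line f -> measurable_fun setT (G f).
Proof.
move=> f2; apply: measurable_funM; first exact: measurable_phi0.
apply: measurable_low_int; apply: measurable_funM; first exact: measurable_dens.
exact: measurable_tail.
Qed.

Lemma tail_abs_le f s : L2 half_line f -> `|tail f s| <= tail (fun y => `|f y|) s.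
Proof.
move=> f2; rewrite /tail /up_int.
have i1 : mu.-integrable `[s, +oo[ (EFin \o (fun y => phi0 y * f y)).
  by apply: integrableS (integrable_phi0M phi_L2 f2).
apply: (le_trans (le_normr_Rintegral _ i1)) => //.
rewrite le_eqVlt; apply/orP; left; apply/eqP/eq_Rintegral => y _.
by rewrite normrM (ger0_norm (phi0_ge0 phi_gt0 y)).
Qed.

Lemma tail_bounded f s : L2 half_line f ->
  `|tail f s| <= \int[mu]_y `|phi0 y * f y|.
Proof.
move=> f2; have iu := integrable_phi0M phi_L2 f2.
have i1 : mu.-integrable `[s, +oo[ (EFin \o (fun y => phi0 y * f y)).
  by apply: integrableS iu.
apply: (le_trans (le_normr_Rintegral _ i1)) => //.
rewrite -lee_fin /Rintegral !fineK; last 2 first.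
- by apply: integrable_fin_num => //; exact: integrable_norm iu.
- by apply: integrable_fin_num => //; exact: integrable_norm i1.
apply: ge0_subset_integral => //=.
by apply/measurable_EFinP; apply: measurableT_comp => //; exact: measurable_phi0M.
Qed.

Lemma integrable_dens_tail f x : L2 half_line f ->
  mu.-integrable `]-oo, x] (EFin \o (fun s => dens s * tail f s)).
Proof.
move=> f2; pose C := \int[mu]_y `|phi0 y * f y|.
apply: (@le_integrable _ _ _ mu _ _ _ (fun s => (C%:E * (dens s)%:E)%E)) => //.
- apply/measurable_EFinP; apply: measurable_funTS; apply: measurable_funM.
    exact: measurable_dens.
  exact: measurable_tail.
- move=> s _ /=; rewrite lee_fin normrM mulrC normrM ler_wpM2r//.
  by apply: (le_trans (tail_bounded s f2)); rewrite ler_norm.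
- by apply: integrableZl => //; exact: integrable_dens.
Qed.

(** The product of [Gop] of [|f|] with [|g|] dominates the inner integral of absolute values; both
    factors being square integrable, Fubini applies. The resulting integral is symmetric in [f] and
    [g], which later gives self-adjointness. *)
Lemma Gop_form f g : L2 half_line f -> L2 half_line g ->
  G (fun y => `|f y|) \in Lfun mu 2%:E ->
  mu.-integrable setT (fun s => (dens s * tail f s * tail g s)%:E) /\
  \int[mu]_(x in half_line) (G f x * g x) =
    \int[mu]_s (dens s * tail f s * tail g s).
Proof.
move=> f2 g2 Gf2.
pose a s := dens s * tail f s; pose v x := phi0 x * g x.
have mT h : L2 half_line h -> measurable_fun setT (fun s => dens s * tail h s).
  move=> h2; apply: measurable_funM; first exact: measurable_dens.
  exact: measurable_tail.
have absf2 := L2_abs measurable_half_line f2.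
have supp : (fun x => v x * low_int a x) =
    (fun x => G f x * g x) \_ half_line.
  apply/funext => x; rewrite patchE in_half_line /v /Gop -/(tail f) -/a.
  case: ifPn => x0; first by ring.
  by rewrite phi0E (negbTE x0) !mul0r.
have [] := @triangular_fubini R v a.
- by move=> x; exact: integrable_dens_tail.
- exact: integrable_phi0M.
- exact: mT.
- have g2' : (fun x => `|g x|) \_ half_line \in Lfun mu 2%:E.
    exact: (L2_abs measurable_half_line g2).
  have /Lfun1_integrable i2 := Lfun2_mul_Lfun1 Gf2 g2'.
  apply: (le_integrable _ _ _ i2) => //.
    apply/measurable_EFinP; apply: measurable_funM.
      by apply: measurableT_comp => //; exact: measurable_phi0M.
    by apply: measurable_low_int; apply: measurableT_comp => //; exact: mT.
  move=> x _; rewrite /= lee_fin patchE in_half_line /v /Gop.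
  rewrite -/(tail (fun y => `|f y|)).
  case: ifPn => x0; last first.
    by rewrite phi0E (negbTE x0) !mul0r !normr0 mul0r normr0.
  rewrite normrM normr_id (normrM (phi0 x)) (normrM _ `|g x|) normr_id.
  rewrite (normrM (phi0 x)) mulrAC ler_wpM2r// ler_wpM2l//.
  rewrite ger0_norm; last by apply: Rintegral_ge0.
  apply: le_trans (ler_norm _); apply: le_Rintegral => //.
  + by apply: integrable_norm => //; exact: integrable_dens_tail.
  + exact: integrable_dens_tail.
  + move=> s _; rewrite /a normrM (ger0_norm (dens_ge0 phi s)).
    by rewrite ler_wpM2l ?dens_ge0//; exact: tail_abs_le.
move=> _ i3 E; split; first exact: i3.
by rewrite Rintegral_mkcond -supp E.
Qed.

End operator.

Section bounded_operator.
Context {R : realType}.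
Local Notation mu := (@lebesgue_measure R).
Variable phi : R -> R.
Hypothesis phi_L2 : L2 half_line phi.
Hypothesis phi_cont : {within `[0, +oo[, continuous phi}.
Hypothesis phi_gt0 : forall x, 0 <= x -> 0 < phi x.
Local Notation G := (Gop phi).
Local Notation dens := (dens phi).
Local Notation tail := (tail phi).
Implicit Types (u v : @L2V R).

(** Equality in [L2V] is equality at every point, so linearity is needed everywhere and not just
    almost everywhere. *)
Lemma Gop_linear a u v x :
  G (L2V_fun (a *: u + v)) x = a * G (L2V_fun u) x + G (L2V_fun v) x.
Proof.
have [x0|x0] := ltP 0 x; last first.
  by rewrite /Gop phi0E ltNge x0/= !mul0r mulr0 addr0.
have k w := Gop_kernel phi_L2 phi_cont phi_gt0 (L2V_L2 w) x0.
rewrite -!(k _).2 /int_op.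
have mH := @measurable_half_line R.
have iau := integrableZl mH a (k u).1.
transitivity (\int[mu]_(y in half_line) (a * (Gker phi x y * L2V_fun u y) +
    Gker phi x y * L2V_fun v y)).
  by apply: eq_Rintegral => y _; rewrite L2V_funD L2V_funZ; ring.
rewrite (RintegralD mH iau (k v).1).
by rewrite RintegralZl//; exact: (k u).1.
Qed.

(** The interface between abstract operators and the kernel: the pointwise values serve the passage
    to limits, the form identity serves the comparison of weights. *)
Record realizes (K : R) (T : {linear @L2V R -> @L2V R}) : Prop := {
  realizes_posop : posop ip K T;
  realizes_Gop : forall u, L2V_fun (T u) = G (L2V_fun u);
  realizes_integrable : forall u, mu.-integrable setT
    (fun s => (dens s * tail (L2V_fun u) s * tail (L2V_fun u) s)%:E);
  realizes_form : forall u, ip (T u) u =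
    \int[mu]_s (dens s * tail (L2V_fun u) s * tail (L2V_fun u) s) }.

Lemma bounded_realizes : bounded_int_op (Gker phi) -> exists K T, realizes K T.
Proof.
move=> [_ [C bC]].
have T2 u : L2 half_line (int_op (Gker phi) (L2V_fun u)).
  by have [] := bC _ (L2V_L2 u).
pose T0 u := L2V_of (T2 u).
have T0E u : L2V_fun (T0 u) = G (L2V_fun u).
  by rewrite L2V_ofE; exact: (Gop_patch phi_L2 phi_cont phi_gt0 (L2V_L2 u)).
have T0lin : linear T0.
  move=> a u v; apply: L2V_inj => x.
  by rewrite L2V_funD L2V_funZ !T0E Gop_linear.
pose T : {linear @L2V R -> @L2V R} :=
  HB.pack_for {linear @L2V R -> @L2V R} T0
    (GRing.isLinear.Build R (@L2V R) (@L2V R) *:%R T0 T0lin).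
have form u v : mu.-integrable setT
      (fun s => (dens s * tail (L2V_fun u) s * tail (L2V_fun v) s)%:E) /\
    ip (T u) v = \int[mu]_s (dens s * tail (L2V_fun u) s * tail (L2V_fun v) s).
  rewrite /ip -[T u]/(T0 u) T0E.
  apply: (Gop_form phi_L2 phi_cont phi_gt0 (L2V_L2 u) (L2V_L2 v)).
  have absu := L2_abs (@measurable_half_line R) (L2V_L2 u).
  by apply/(L2_int_op phi_L2 phi_cont phi_gt0 absu); have [] := bC _ absu.
(* Boundedness does not state that [C] is non-negative, whereas [posop] asks for it. *)
exists (Num.max C 0), T; split.
- split.
  + by rewrite le_max lexx orbT.
  + move=> u v; rewrite (form u v).2 (formC ip_form) (form v u).2.
    by apply: eq_Rintegral => s _; ring.
  + move=> u; rewrite (form u u).2; apply: Rintegral_ge0 => s _.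
    by rewrite -mulrA mulr_ge0 ?dens_ge0// -expr2 sqr_ge0.
  + move=> u; have [_] := bC _ (L2V_L2 u).
    rewrite (L2norm_L2V_of (T2 u)) L2norm_ip -EFinM lee_fin -[L2V_of _]/(T u) => h.
    have {}h : Num.sqrt (ip (T u) (T u)) <= Num.max C 0 * Num.sqrt (ip u u).
      by apply: (le_trans h); rewrite ler_wpM2r ?sqrtr_ge0// le_max lexx.
    rewrite -(sqr_sqrtr (ip_ge0 (T u))) -(sqr_sqrtr (ip_ge0 u)) -exprMn.
    rewrite lerXn2r ?nnegrE ?sqrtr_ge0//.
    by rewrite mulr_ge0 ?sqrtr_ge0// le_max lexx orbT.
- exact: T0E.
- by move=> u; exact: (form u u).1.
- by move=> u; exact: (form u u).2.
Qed.

(** Cauchy-Schwarz with weight [dens] on []-oo, x]], obtained from the non-negative integrals of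
    [dens * (a + b U)^2]; enlarging the ray to the whole line then gives the form. Smallness of the
    form thus controls the values at each point. *)
Lemma Gop_sqr_le K T u x : realizes K T ->
  L2V_fun (T u) x ^+ 2 <= phi0 phi x ^+ 2 * (low_int dens x * ip (T u) u).
Proof.
move=> TP; have iq := realizes_integrable TP u.
rewrite (realizes_Gop TP) (realizes_form TP).
rewrite /Gop exprMn ler_wpM2l ?sqr_ge0//.
set U := tail _.
have mx := measurable_ray x.
have i1 : mu.-integrable `]-oo, x] (EFin \o dens) by exact: integrable_dens.
have i2 : mu.-integrable `]-oo, x] (EFin \o (fun s => dens s * U s)).
  by apply: integrable_dens_tail => //; exact: L2V_L2.
have i3 : mu.-integrable `]-oo, x] (EFin \o (fun s => dens s * U s * U s)).
  by apply: integrableS iq.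
apply: (@le_trans _ _ (low_int dens x *
    \int[mu]_(s in `]-oo, x]) (dens s * U s * U s))).
  apply: quadratic_form_disc => a b.
  rewrite -(RintegralZl _ mx i1) -(RintegralZl _ mx i2) -(RintegralZl _ mx i3).
  have j1 : mu.-integrable `]-oo, x] (EFin \o (fun s => a ^+ 2 * dens s)).
    exact: (integrableZl mx _ i1).
  have j2 : mu.-integrable `]-oo, x]
      (EFin \o (fun s => 2 * a * b * (dens s * U s))).
    exact: (integrableZl mx _ i2).
  have j3 : mu.-integrable `]-oo, x]
      (EFin \o (fun s => b ^+ 2 * (dens s * U s * U s))).
    exact: (integrableZl mx _ i3).
  rewrite -(RintegralD mx j1 j2) -(RintegralD mx (integrableD mx j1 j2) j3).
  apply: Rintegral_ge0 => s _.
  have -> : a ^+ 2 * dens s + 2 * a * b * (dens s * U s) +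
    b ^+ 2 * (dens s * U s * U s) = dens s * (a + b * U s) ^+ 2 by ring.
  by rewrite mulr_ge0 ?sqr_ge0 ?dens_ge0.
rewrite ler_wpM2l ?low_int_dens_ge0//.
rewrite -lee_fin /Rintegral !fineK; last 2 first.
- exact: integrable_fin_num iq.
- exact: integrable_fin_num i3.
apply: ge0_subset_integral => //=.
- by have /integrableP[] := iq.
- move=> s _; rewrite lee_fin -mulrA mulr_ge0 ?dens_ge0// -expr2 sqr_ge0//.
Qed.

End bounded_operator.

(** * Comparison of two weights *)

Section comparison.
Context {R : realType}.
Local Notation mu := (@lebesgue_measure R).
Variables (phi1 phi2 : R -> R) (c : R).
Hypothesis phi1_L2 : L2 half_line phi1.
Hypothesis phi1_cont : {within `[0, +oo[, continuous phi1}.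
Hypothesis phi1_gt0 : forall x, 0 <= x -> 0 < phi1 x.
Hypothesis phi2_L2 : L2 half_line phi2.
Hypothesis phi2_cont : {within `[0, +oo[, continuous phi2}.
Hypothesis phi2_gt0 : forall x, 0 <= x -> 0 < phi2 x.
Hypothesis c_gt0 : 0 < c.
Hypothesis phi12 : forall x, 0 <= x -> c^-1 <= phi2 x / phi1 x <= c.

Lemma phi2_le x : 0 <= x -> phi2 x <= c * phi1 x.
Proof.
by move=> x0; have /andP[_] := phi12 x0; rewrite ler_pdivrMr// phi1_gt0.
Qed.

Lemma phi1_le x : 0 <= x -> phi1 x <= c * phi2 x.
Proof.
move=> x0; have /andP[+ _] := phi12 x0; rewrite ler_pdivlMr ?phi1_gt0//.
by rewrite mulrC ler_pdivrMr// mulrC.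
Qed.

Lemma dens_le s : dens phi2 s <= c ^+ 2 * dens phi1 s.
Proof.
rewrite !densE; case: ifPn => s0; last by rewrite mulr0.
have p1 := phi1_gt0 (ltW s0); have p2 := phi2_gt0 (ltW s0).
rewrite ler_pdivlMr ?exprn_gt0// mulrC ler_pdivrMr ?exprn_gt0// -exprMn.
by rewrite lerXn2r ?nnegrE ?mulr_ge0 ?phi1_le// ltW.
Qed.

Lemma low_int_dens_comparison x :
  low_int (dens phi2) x <= c ^+ 2 * low_int (dens phi1) x.
Proof.
have mx := measurable_ray x.
have i1 := integrable_dens phi1_cont phi1_gt0 x.
have i2 := integrable_dens phi2_cont phi2_gt0 x.
rewrite -(RintegralZl _ mx i1); apply: le_Rintegral => //.
  exact: (integrableZl mx _ i1).
by move=> s _; exact: dens_le.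
Qed.

(** Each of the two factors [phi2] costs one [c], and the integral of [phi2^-2] costs [c^2]. *)
Lemma Gker_ge0_le x y : 0 < x -> 0 < y ->
  0 <= Gker phi2 x y <= c ^+ 4 * Gker phi1 x y.
Proof.
move=> x0 y0; rewrite (GkerE phi1_cont phi1_gt0)// (GkerE phi2_cont phi2_gt0)//.
have p1x := phi1_gt0 (ltW x0); have p1y := phi1_gt0 (ltW y0).
have p2x := phi2_gt0 (ltW x0); have p2y := phi2_gt0 (ltW y0).
have S0 := low_int_dens_ge0 phi2 (Num.min x y).
rewrite !mulr_ge0 ?(ltW p2x) ?(ltW p2y)//=.
have -> : c ^+ 4 * (phi1 x * phi1 y * low_int (dens phi1) (Num.min x y)) =
  (c * phi1 x) * (c * phi1 y) * (c ^+ 2 * low_int (dens phi1) (Num.min x y)).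
  by ring.
apply: ler_pM => //; first by rewrite mulr_ge0// ltW.
  by apply: ler_pM; rewrite ?(ltW p2x) ?(ltW p2y) ?phi2_le// ltW.
exact: low_int_dens_comparison.
Qed.

Lemma int_op_comparison f x : L2 half_line f -> 0 < x ->
  `|int_op (Gker phi2) f x| <= c ^+ 4 * int_op (Gker phi1) (fun y => `|f y|) x.
Proof.
move=> f2 x0.
have mH := @measurable_half_line R.
have absf2 := L2_abs mH f2.
have i1 := (Gop_kernel phi1_L2 phi1_cont phi1_gt0 absf2 x0).1.
have i2 := (Gop_kernel phi2_L2 phi2_cont phi2_gt0 f2 x0).1.
apply: (le_trans (le_normr_Rintegral mH i2)).
rewrite /int_op -(RintegralZl _ mH i1); apply: le_Rintegral => //.
- exact: (integrable_norm i2).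
- exact: (integrableZl mH _ i1).
- move=> y; rewrite /half_line/= in_itv/= andbT => y0.
  have /andP[G0 Gle] := Gker_ge0_le x0 y0.
  by rewrite normrM ger0_norm// mulrA ler_wpM2r.
Qed.

Lemma bounded_int_op_comparison :
  bounded_int_op (Gker phi1) -> bounded_int_op (Gker phi2).
Proof.
move=> [_ [C bC]].
have mH := @measurable_half_line R.
split.
  move=> f f2; apply/nearW => x; rewrite /half_line/= in_itv/= andbT => x0.
  by have [] := Gop_kernel phi2_L2 phi2_cont phi2_gt0 f2 x0.
exists (c ^+ 4 * C) => f f2; have absf2 := L2_abs mH f2.
have [h1 h2] := bC _ absf2.
have mGf : measurable_fun half_line (int_op (Gker phi2) f).
  apply/(measurable_restrictT _ (@measurable_half_line R)).
  rewrite (Gop_patch phi2_L2 phi2_cont phi2_gt0 f2).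
  exact: measurable_Gop.
have [] := @le_L2norm _ _ (int_op (Gker phi2) f)
  (int_op (Gker phi1) (fun y => `|f y|)) (c ^+ 4) mH mGf h1.
- by rewrite exprn_ge0// ltW.
- move=> x /mem_set; rewrite in_half_line => x0.
  apply: (le_trans (int_op_comparison f2 x0)).
  by rewrite ler_wpM2l ?ler_norm// exprn_ge0// ltW.
move=> h3 h4; split=> //; apply: (le_trans h4).
rewrite [(c ^+ 4 * C)%:E]EFinM -muleA.
rewrite lee_wpmul2l ?lee_fin ?exprn_ge0 ?(ltW c_gt0)//.
apply: (le_trans h2); rewrite le_eqVlt; apply/orP; left; apply/eqP.
congr (_ * _)%E; rewrite !L2normE//; congr ((Num.sqrt _)%:E).
by apply: eq_Rintegral => x _; rewrite -!expr2 real_normK ?num_real.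
Qed.

(** This is [phi2 / phi1] on the half-line and 0 elsewhere, written as a product of functions
    already known to be measurable. *)
Definition ratio x : R := phi0 phi2 x * (phi0 phi1 x * dens phi1 x).

Lemma ratioE x : 0 < x -> ratio x = phi2 x / phi1 x.
Proof.
move=> x0; rewrite /ratio !phi0E densE x0; congr (_ * _).
by rewrite expr2 invfM mulrA divff ?mul1r// gt_eqF// phi1_gt0// ltW.
Qed.

Lemma ratio_phi0 x : phi0 phi1 x * ratio x = phi0 phi2 x.
Proof.
have [x0|x0] := ltP 0 x; last by rewrite /ratio !phi0E ltNge x0/= !mul0r.
have p1 : phi1 x != 0 by rewrite gt_eqF// phi1_gt0// ltW.
by rewrite ratioE// !phi0E x0 mulrCA divff// mulr1.
Qed.

Lemma L2_ratioM (u : @L2V R) :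
  L2 half_line (fun x => ratio x * L2V_fun u x) /\
  (L2norm half_line (fun x => (ratio x * L2V_fun u x)%R) <=
    c%:E * L2norm half_line (L2V_fun u))%E.
Proof.
apply: le_L2norm; [exact: measurable_half_line| |exact: L2V_L2|exact: ltW|].
  apply: measurable_funTS; apply: measurable_funM; last exact: measurable_L2V_fun.
  apply: measurable_funM; first exact: measurable_phi0.
  by apply: measurable_funM; [exact: measurable_phi0|exact: measurable_dens].
move=> x /mem_set; rewrite in_half_line => x0.
rewrite normrM ratioE// ler_wpM2r//.
rewrite ger0_norm; last first.
  by rewrite divr_ge0 ?(ltW (phi1_gt0 _)) ?(ltW (phi2_gt0 _)) ?ltW.
by have /andP[] := phi12 (ltW x0).
Qed.

Lemma ratio_operator : exists W : {linear @L2V R -> @L2V R},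
  (forall u x, L2V_fun (W u) x = ratio x * L2V_fun u x) /\
  (forall u, ip (W u) (W u) <= c ^+ 2 * ip u u).
Proof.
have [L2r Lnr] := all_and2 L2_ratioM.
pose W0 u := L2V_of (L2r u).
have W0E u x : L2V_fun (W0 u) x = ratio x * L2V_fun u x.
  rewrite L2V_ofE patchE in_half_line; case: ifPn => // x0.
  by rewrite /ratio phi0E (negbTE x0) !mul0r.
have W0lin : linear W0.
  move=> a u v; apply: L2V_inj => x.
  by rewrite L2V_funD L2V_funZ !W0E L2V_funD L2V_funZ; ring.
pose W : {linear @L2V R -> @L2V R} :=
  HB.pack_for {linear @L2V R -> @L2V R} W0
    (GRing.isLinear.Build R (@L2V R) (@L2V R) *:%R W0 W0lin).
exists W; split; first exact: W0E.
move=> u; have := Lnr u.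
rewrite (L2norm_L2V_of (L2r u)) L2norm_ip -EFinM lee_fin.
rewrite -[L2V_of _]/(W u) => h.
rewrite -(sqr_sqrtr (ip_ge0 (W u))) -(sqr_sqrtr (ip_ge0 u)) -exprMn.
by rewrite lerXn2r ?nnegrE ?sqrtr_ge0// mulr_ge0 ?sqrtr_ge0// ltW.
Qed.

Lemma form_comparison K1 K2 (T1 T2 W : {linear @L2V R -> @L2V R}) :
  realizes phi1 K1 T1 -> realizes phi2 K2 T2 ->
  (forall u x, L2V_fun (W u) x = ratio x * L2V_fun u x) ->
  forall u, ip (T2 u) u <= c ^+ 2 * ip (T1 (W u)) (W u).
Proof.
move=> TP1 TP2 WE u; rewrite (realizes_form TP1) (realizes_form TP2).
have := realizes_integrable TP1 (W u).
have -> : tail phi1 (L2V_fun (W u)) = tail phi2 (L2V_fun u).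
  apply/funext => s; apply: eq_Rintegral => y _.
  by rewrite WE mulrA ratio_phi0.
move=> i1u; rewrite -(RintegralZl _ measurableT i1u); apply: le_Rintegral => //.
- exact: (realizes_integrable TP2 u).
- exact: (integrableZl measurableT _ i1u).
- move=> s _; set t := tail _ _ _.
  have -> : dens phi2 s * t * t = dens phi2 s * t ^+ 2 by ring.
  have -> : c ^+ 2 * (dens phi1 s * t * t) = (c ^+ 2 * dens phi1 s) * t ^+ 2.
    by ring.
  by rewrite ler_wpM2r ?sqr_ge0// dens_le.
Qed.

End comparison.

Lemma real_cauchy_cvg (R : realType) (a : nat -> R) :
  (forall eps, 0 < eps -> exists n0, forall n m, (n0 <= n)%N -> (n0 <= m)%N ->
    `|a n - a m| < eps) -> cvgn a.
Proof.
move=> h; apply/cauchy_cvgP/cauchyP => eps eps0.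
have [n0 n0P] := h _ eps0; exists (a n0); exists n0 => // n /= nn.
by rewrite -ball_normE /ball_/= n0P.
Qed.

(** * From Cauchy in the form to convergence in norm *)

Section compactness.
Context {R : realType}.
Local Notation mu := (@lebesgue_measure R).

Lemma fatou_sqr (F : nat -> R -> R) (g : R -> R) n0 eps :
  (forall m, measurable_fun half_line (F m)) ->
  (forall x, 0 < x -> F m x @[m --> \oo] --> g x) ->
  (forall m, (n0 <= m)%N ->
    \int[mu]_(x in half_line) (F m x ^+ 2)%:E <= eps%:E)%E ->
  (\int[mu]_(x in half_line) (g x ^+ 2)%:E <= eps%:E)%E.
Proof.
move=> mF Fg Feps.
have mH := @measurable_half_line R.
have mF2 m : measurable_fun half_line (fun x => (F m x ^+ 2)%:E).
  by apply/measurable_EFinP; exact: measurable_funX.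
have F0 m x : half_line x -> (0 <= (F m x ^+ 2)%:E)%E.
  by rewrite lee_fin sqr_ge0.
apply: (@le_trans _ _
    (limn_einf (fun m => \int[mu]_(x in half_line) (F m x ^+ 2)%:E)%E)).
  apply: le_trans (fatou mu mH mF2 F0).
  rewrite le_eqVlt; apply/orP; left; apply/eqP; apply: eq_integral => x.
  rewrite in_half_line => x0.
  have h : (F m x ^+ 2)%:E @[m --> \oo] --> (g x ^+ 2)%:E.
    apply/fine_cvgP; split; first by apply: nearW => m; rewrite fin_numE.
    rewrite (_ : fine \o _ = (fun m => F m x * F m x)); last first.
      by apply/funext => m; rewrite /= expr2.
    by rewrite expr2; exact: cvgM (Fg _ x0) (Fg _ x0).
  rewrite is_cvg_limn_einfE; first by rewrite (cvg_lim _ h).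
  by apply/cvg_ex; eexists; exact: h.
rewrite limn_einf_lim; apply: lime_le; first exact: is_cvg_einfs.
(* Each tail infimum is at most its term at [maxn n n0], where the assumed bound is available. *)
apply: nearW => n; apply: (@le_trans _ _
  (\int[mu]_(x in half_line) (F (maxn n n0) x ^+ 2)%:E)%E).
  by apply: ereal_inf_lbound; exists (maxn n n0) => //=; exact: leq_maxl.
by apply: Feps; exact: leq_maxr.
Qed.

Section one_operator.
Variable phi : R -> R.
Hypothesis phi_L2 : L2 half_line phi.
Hypothesis phi_cont : {within `[0, +oo[, continuous phi}.
Hypothesis phi_gt0 : forall x, 0 <= x -> 0 < phi x.
Variables (K : R) (T : {linear @L2V R -> @L2V R}).
Hypothesis TG : realizes phi K T.
Let TE := realizes_Gop TG.

Lemma int_op_L2V_of f (f2 : L2 half_line f) x : 0 < x ->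
  int_op (Gker phi) f x = L2V_fun (T (L2V_of f2)) x.
Proof.
move=> x0; rewrite TE -(Gop_kernel phi_L2 phi_cont phi_gt0 (L2V_L2 _) x0).2.
by apply: eq_Rintegral => y yH; rewrite L2V_ofE patchE yH.
Qed.

Lemma compact_compactop : compact_int_op (Gker phi) -> compactop ip T.
Proof.
move=> [_ cG] u M uM.
have [|k [g [kmono g2 kg]]] := cG (fun n => L2V_fun (u n)) (Num.sqrt M).
  move=> n; split; first exact: L2V_L2.
  by rewrite L2norm_ip lee_fin ler_wsqrtr.
exists k, (L2V_of g2); split=> // eps eps0.
have E n : L2norm half_line (int_op (Gker phi) (L2V_fun (u (k n))) \- g) =
    (Num.sqrt (ip (T (u (k n)) - L2V_of g2) (T (u (k n)) - L2V_of g2)))%:E.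
  rewrite -L2norm_ip; apply: eq_L2norm => x xH.
  have x0 : 0 < x by rewrite -in_half_line.
  rewrite L2V_funD L2V_funN L2V_ofE patchE xH TE.
  by rewrite -(Gop_kernel phi_L2 phi_cont phi_gt0 (L2V_L2 _) x0).2.
move: kg; under eq_fun do rewrite E.
move=> /fine_cvgP[_] /= /cvgrPdist_lt /(_ (Num.sqrt eps)).
rewrite sqrtr_gt0 => /(_ eps0)[n0 _ n0P]; exists n0 => n nn.
have := n0P n nn; rewrite /= sub0r normrN ger0_norm ?sqrtr_ge0//.
by rewrite ltr_sqrt.
Qed.

Lemma form_cauchy_cvg (h : nat -> @L2V R) :
  (forall eps, 0 < eps -> exists n0, forall n m, (n0 <= n)%N -> (n0 <= m)%N ->
      ip (T (h n - h m)) (h n - h m) < eps) ->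
  exists g, forall eps, 0 < eps -> exists n0, forall n, (n0 <= n)%N ->
    ip (T (h n) - g) (T (h n) - g) <= eps.
Proof.
move=> hC; have TP := realizes_posop TG.
have mH := @measurable_half_line R.
pose F n := L2V_fun (T (h n)).
have FB n m x : F n x - F m x = L2V_fun (T (h n - h m)) x.
  by rewrite linearB L2V_funD L2V_funN.
have cF x : 0 < x -> cvgn (fun n => F n x).
  move=> x0; apply: real_cauchy_cvg => eps eps0.
  (* [c] is the factor of the form in [Gop_sqr_le]; dividing by [c + 1] avoids a zero denominator
     and leaves a strict bound. *)
  pose c := phi0 phi x ^+ 2 * low_int (dens phi) x.
  have c0 : 0 <= c by rewrite mulr_ge0 ?sqr_ge0 ?low_int_dens_ge0.
  have [] := hC (eps ^+ 2 / (c + 1)).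
    by rewrite divr_gt0 ?exprn_gt0// ltr_wpDl.
  move=> n0 n0P; exists n0 => n m nn nm; rewrite FB.
  rewrite -ltr_sqr ?nnegrE//; last exact: ltW.
  rewrite real_normK ?num_real//.
  apply: (le_lt_trans (Gop_sqr_le phi_L2 phi_cont phi_gt0 _ x TG)).
  rewrite mulrA -/c.
  apply: (@le_lt_trans _ _ (c * (eps ^+ 2 / (c + 1)))).
    by rewrite ler_wpM2l// ltW// n0P.
  rewrite mulrCA gtr_pMr ?exprn_gt0// ltr_pdivrMr ?ltr_wpDl// mul1r.
  by rewrite ltrDl.
pose g := (fun x => limn (fun n => F n x)) \_ half_line.
have FgH n x : 0 < x -> (F n x - F m x) @[m --> \oo] --> F n x - g x.
  move=> x0; apply: cvgB; first exact: cvg_cst.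
  by rewrite /g patchE in_half_line x0; exact: cF.
have mF n : measurable_fun half_line (F n).
  by apply: measurable_funTS; exact: measurable_L2V_fun.
have K0 := posop_ge0 TP.
have bound eps : 0 < eps -> exists n0, forall n, (n0 <= n)%N ->
    (\int[mu]_(x in half_line) ((F n x - g x) ^+ 2)%:E <= eps%:E)%E.
  move=> eps0; have [] := hC (eps / (K + 1)).
    by rewrite divr_gt0// ltr_wpDl.
  move=> n0 n0P; exists n0 => n nn.
  (* Here [n] stays fixed and [m] tends to infinity, so the estimate for [F n - F m] passes to
     [F n - g]. *)
  apply: (@fatou_sqr (fun m x => F n x - F m x) _ n0) => //.
  - by move=> m; exact: measurable_funB.
  - by move=> x x0; exact: FgH.
  - move=> m nm.
    have -> : (\int[mu]_(x in half_line) ((F n x - F m x) ^+ 2)%:E =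
        (ip (T (h n - h m)) (T (h n - h m)))%:E)%E.
      rewrite /ip /Rintegral fineK; last first.
        exact: (integrable_fin_num mH (integrable_L2V _ _)).
      by apply: eq_integral => x _; rewrite FB expr2.
    rewrite lee_fin.
    apply: (le_trans (posop_sqnorm_le (@ip_form R) (@ip_ge0 R) TP _)).
    apply: (@le_trans _ _ (K * (eps / (K + 1)))).
      by rewrite ler_wpM2l// ltW// n0P.
    rewrite mulrCA ger_pMr// ler_pdivrMr ?ltr_wpDl// mul1r.
    by rewrite lerDl.
have mg : measurable_fun half_line g.
  apply: (@measurable_fun_cvg _ _ _ _ F) => // x.
  rewrite /half_line/= in_itv/= andbT => x0.
  by rewrite /g patchE in_half_line x0; exact: cF.
(* Square integrability of [g] is not known beforehand: Fatou gives it for [F n0 - g], and [g] is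
   recovered by subtracting this from [T (h n0)]. *)
have [n0 n0P] := bound 1 ltr01.
have d2 : L2 half_line (fun x => F n0 x - g x).
  apply/L2P; first exact: measurable_half_line.
  have md : measurable_fun half_line (fun x => F n0 x - g x).
    exact: measurable_funB.
  split=> //; apply/integrableP; split.
    by apply/measurable_EFinP; exact: measurable_funX.
  apply: (@le_lt_trans _ _ 1%:E); last exact: ltry.
  apply: le_trans (n0P _ (leqnn _)); rewrite le_eqVlt; apply/orP; left; apply/eqP.
  by apply: eq_integral => x _; rewrite gee0_abs// lee_fin sqr_ge0.
pose gV := T (h n0) - L2V_of d2.
have gVE x : 0 < x -> L2V_fun gV x = g x.
  move=> x0; rewrite L2V_funD L2V_funN L2V_ofE patchE in_half_line x0.
  by rewrite opprB addrCA subrr addr0.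
exists gV => eps /bound[n1 n1P]; exists n1 => n nn.
rewrite -lee_fin; apply: le_trans (n1P n nn).
rewrite /ip /Rintegral fineK; last first.
  exact: (integrable_fin_num mH (integrable_L2V _ _)).
rewrite le_eqVlt; apply/orP; left; apply/eqP; apply: eq_integral => x.
by rewrite in_half_line => x0; rewrite L2V_funD L2V_funN gVE// -expr2.
Qed.

End one_operator.
End compactness.

Section compact_comparison.
Context {R : realType}.
Variables (phi1 phi2 : R -> R) (c : R).
Hypothesis phi1_L2 : L2 half_line phi1.
Hypothesis phi1_cont : {within `[0, +oo[, continuous phi1}.
Hypothesis phi1_gt0 : forall x, 0 <= x -> 0 < phi1 x.
Hypothesis phi2_L2 : L2 half_line phi2.
Hypothesis phi2_cont : {within `[0, +oo[, continuous phi2}.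
Hypothesis phi2_gt0 : forall x, 0 <= x -> 0 < phi2 x.
Hypothesis c_gt0 : 0 < c.
Hypothesis phi12 : forall x, 0 <= x -> c^-1 <= phi2 x / phi1 x <= c.

Lemma compact_int_op_comparison :
  compact_int_op (Gker phi1) -> compact_int_op (Gker phi2).
Proof.
move=> cG1; have bG1 := cG1.1.
have bG2 := bounded_int_op_comparison phi1_L2 phi1_cont phi1_gt0 phi2_L2
  phi2_cont phi2_gt0 c_gt0 phi12 bG1.
split=> // f_ M fM.
have [K1 [T1 TG1]] := bounded_realizes phi1_L2 phi1_cont phi1_gt0 bG1.
have [K2 [T2 TG2]] := bounded_realizes phi2_L2 phi2_cont phi2_gt0 bG2.
have [W [WE Wle]] := ratio_operator phi1_L2 phi1_cont phi1_gt0 phi2_L2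
  phi2_gt0 c_gt0 phi12.
have le21 := form_comparison phi1_gt0 phi2_gt0 c_gt0 phi12 TG1 TG2 WE.
have C1 := compact_compactop phi1_L2 phi1_cont phi1_gt0 TG1 cG1.
have [f2 fMn] := all_and2 fM.
pose u n := L2V_of (f2 n).
have uM n : ip (u n) (u n) <= M ^+ 2.
  have := fMn n; rewrite (L2norm_L2V_of (f2 n)) lee_fin => h.
  rewrite -(sqr_sqrtr (ip_ge0 (u n))) lerXn2r ?nnegrE ?sqrtr_ge0//.
  exact: le_trans (sqrtr_ge0 _) h.
have c20 : 0 <= c ^+ 2 by exact: sqr_ge0.
have [k [kmono kC]] := compactop_form_cauchy (@ip_form R) (@ip_ge0 R)
  (realizes_posop TG1) C1 c20 c20 le21 Wle uM.
have [g gP] := form_cauchy_cvg phi2_L2 phi2_cont phi2_gt0 TG2 kC.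
exists k, (L2V_fun g); split=> //; first exact: L2V_L2.
have E n : L2norm half_line (int_op (Gker phi2) (f_ (k n)) \- L2V_fun g) =
    (Num.sqrt (ip (T2 (u (k n)) - g) (T2 (u (k n)) - g)))%:E.
  rewrite -L2norm_ip; apply: eq_L2norm => x; rewrite in_half_line => x0.
  rewrite L2V_funD L2V_funN/=.
  by rewrite (int_op_L2V_of phi2_L2 phi2_cont phi2_gt0 TG2 (f2 _) x0).
under eq_fun do rewrite E.
apply/fine_cvgP; split; first by apply: nearW => m; rewrite fin_numE.
apply/cvgrPdist_le => eps eps0; have [n0 n0P] := gP _ (exprn_gt0 2 eps0).
exists n0 => // n /= nn; rewrite sub0r normrN ger0_norm ?sqrtr_ge0//.
by rewrite -(ger0_norm (ltW eps0)) -sqrtr_sqr ler_wsqrtr// n0P.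
Qed.

End compact_comparison.

(** * Eigenvalues of the integral operators *)

Section eigenvalues.
Context {R : realType}.
Local Notation mu := (@lebesgue_measure R).
Variable phi : R -> R.
Hypothesis phi_L2 : L2 half_line phi.
Hypothesis phi_cont : {within `[0, +oo[, continuous phi}.
Hypothesis phi_gt0 : forall x, 0 <= x -> 0 < phi x.
Variables (K : R) (T : {linear @L2V R -> @L2V R}).
Hypothesis TG : realizes phi K T.

Lemma eigenvector_L2V u lambda :
  ip (T u - lambda *: u) (T u - lambda *: u) = 0 <->
  Defs.eigenspace (int_op (Gker phi)) lambda (L2V_fun u).
Proof.
have E x : half_line x -> L2V_fun (T u - lambda *: u) x =
    int_op (Gker phi) (L2V_fun u) x - lambda * L2V_fun u x.
  move=> Hx; have x0 : 0 < x by rewrite -in_half_line mem_set.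
  rewrite L2V_funD L2V_funN L2V_funZ (realizes_Gop TG).
  by rewrite (Gop_kernel phi_L2 phi_cont phi_gt0 (L2V_L2 u) x0).2.
rewrite ip_null_ae; split=> [ae0|[_ ae0]].
  split; first exact: L2V_L2.
  by apply: filterS ae0 => x /= h Hx; apply/eqP; rewrite -subr_eq0 -E// h.
by apply: filterS ae0 => x /= h Hx; rewrite E// h// subrr.
Qed.

Lemma eigenspace_L2V_of f (f2 : L2 half_line f) lambda :
  Defs.eigenspace (int_op (Gker phi)) lambda f ->
  Defs.eigenspace (int_op (Gker phi)) lambda (L2V_fun (L2V_of f2)).
Proof.
move=> [_ fE]; split; first exact: L2V_L2.
apply: filterS fE => x /= h Hx.
have Hx' : x \in half_line by rewrite inE.
rewrite L2V_ofE patchE Hx' -h//; apply: eq_Rintegral => y yH.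
by rewrite patchE yH.
Qed.

(** The basis functions are replaced by their cut-offs, which differ from them only outside the
    half-line, while all conditions on the basis are equalities almost everywhere on it. *)
Lemma eigenvalue_sequence_eigenseq m :
  eigenvalue_sequence (int_op (Gker phi)) m -> eigenseq ip T m.
Proof.
move=> [mhomo mE]; split; first exact: mhomo.
move=> lambda; have [k [[e [eE efree espan]] mk]] := mE lambda.
exists k; split=> //.
have e2 i : L2 half_line (e i) by have [] := eE i.
exists (fun i => L2V_of (e2 i)).
have sumE (a : 'I_k -> R) x : half_line x ->
    L2V_fun (\sum_i a i *: L2V_of (e2 i)) x = \sum_(i < k) a i * e i x.
  move=> Hx; rewrite L2V_fun_sum; apply: eq_bigr => i _.
  by rewrite L2V_funZ L2V_ofE patchE mem_set.
split.
- by move=> i; apply/eigenvector_L2V/eigenspace_L2V_of.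
- move=> a /ip_null_ae ae0; apply: efree.
  by apply: filterS ae0 => x /= h Hx; rewrite -sumE// h.
- move=> f /eigenvector_L2V/espan[a fa]; exists a; apply/ip_null_ae.
  apply: filterS fa => x /= h Hx.
  by rewrite L2V_funD L2V_funN sumE// h// subrr.
Qed.

End eigenvalues.

Section eigenvalue_comparison.
Context {R : realType}.
Variables (phi1 phi2 : R -> R) (c : R).
Hypothesis phi1_L2 : L2 half_line phi1.
Hypothesis phi1_cont : {within `[0, +oo[, continuous phi1}.
Hypothesis phi1_gt0 : forall x, 0 <= x -> 0 < phi1 x.
Hypothesis phi2_L2 : L2 half_line phi2.
Hypothesis phi2_cont : {within `[0, +oo[, continuous phi2}.
Hypothesis phi2_gt0 : forall x, 0 <= x -> 0 < phi2 x.
Hypothesis c_gt0 : 0 < c.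
Hypothesis phi12 : forall x, 0 <= x -> c^-1 <= phi2 x / phi1 x <= c.

Lemma eigenvalue_comparison mu1 mu2 n :
  compact_int_op (Gker phi1) ->
  eigenvalue_sequence (int_op (Gker phi1)) mu1 ->
  eigenvalue_sequence (int_op (Gker phi2)) mu2 ->
  mu2 n <= c ^+ 4 * mu1 n.
Proof.
move=> cG1 E1 E2; have bG1 := cG1.1.
have bG2 := bounded_int_op_comparison phi1_L2 phi1_cont phi1_gt0 phi2_L2
  phi2_cont phi2_gt0 c_gt0 phi12 bG1.
have [K1 [T1 TG1]] := bounded_realizes phi1_L2 phi1_cont phi1_gt0 bG1.
have [K2 [T2 TG2]] := bounded_realizes phi2_L2 phi2_cont phi2_gt0 bG2.
have [W [WE Wle]] := ratio_operator phi1_L2 phi1_cont phi1_gt0 phi2_L2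
  phi2_gt0 c_gt0 phi12.
have le21 := form_comparison phi1_gt0 phi2_gt0 c_gt0 phi12 TG1 TG2 WE.
have C1 := compact_compactop phi1_L2 phi1_cont phi1_gt0 TG1 cG1.
have -> : c ^+ 4 = c ^+ 2 * c ^+ 2 by rewrite -exprD.
by apply: (eigen_le (@ip_form R) (@ip_ge0 R) n (realizes_posop TG1)
  (realizes_posop TG2) C1 _ _ le21 Wle
  (eigenvalue_sequence_eigenseq phi1_L2 phi1_cont phi1_gt0 TG1 E1)
  (eigenvalue_sequence_eigenseq phi2_L2 phi2_cont phi2_gt0 TG2 E2));
  exact: sqr_ge0.
Qed.

End eigenvalue_comparison.

Theorem theorem19 (R : realType) (phi1 phi2 : R -> R) (c : R)
    (phi1_L2 : L2 half_line phi1) (phi1_W : W12loc phi1)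
    (phi1_gt0 : forall x, 0 <= x -> 0 < phi1 x)
    (phi2_L2 : L2 half_line phi2) (phi2_W : W12loc phi2)
    (phi2_gt0 : forall x, 0 <= x -> 0 < phi2 x)
    (c_gt0 : 0 < c)
    (phi12 : forall x, 0 <= x -> c^-1 <= phi2 x / phi1 x <= c) :
  [/\ bounded_int_op (Gker phi1) <-> bounded_int_op (Gker phi2),
      compact_int_op (Gker phi1) <-> compact_int_op (Gker phi2) &
      compact_int_op (Gker phi1) -> compact_int_op (Gker phi2) ->
      forall mu1 mu2 : nat -> R,
        eigenvalue_sequence (int_op (Gker phi1)) mu1 ->
        eigenvalue_sequence (int_op (Gker phi2)) mu2 ->
        forall n : nat, c ^- 4 * mu1 n <= mu2 n <= c ^+ 4 * mu1 n].
Proof.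
have [cont1 _] := phi1_W; have [cont2 _] := phi2_W.
(* Inverting the ratio exchanges its two bounds, so each comparison also applies with the roles
   swapped; the swapped eigenvalue bound is the lower one. *)
have phi21 x : 0 <= x -> c^-1 <= phi1 x / phi2 x <= c.
  move=> x0; have p1 := phi1_gt0 _ x0; have p2 := phi2_gt0 _ x0.
  have /andP[] := phi12 _ x0.
  rewrite -[phi1 x / phi2 x]invf_div lef_pV2 ?posrE ?divr_gt0// => h ->/=.
  by rewrite -[leRHS]invrK lef_pV2 ?posrE ?invr_gt0 ?divr_gt0.
split.
- split; [exact: (bounded_int_op_comparison phi1_L2 cont1 phi1_gt0 phi2_L2
    cont2 phi2_gt0 c_gt0 phi12)|exact: (bounded_int_op_comparison phi2_L2 cont2
    phi2_gt0 phi1_L2 cont1 phi1_gt0 c_gt0 phi21)].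
- split; [exact: (compact_int_op_comparison phi1_L2 cont1 phi1_gt0 phi2_L2
    cont2 phi2_gt0 c_gt0 phi12)|exact: (compact_int_op_comparison phi2_L2 cont2
    phi2_gt0 phi1_L2 cont1 phi1_gt0 c_gt0 phi21)].
- move=> C1 C2 mu1 mu2 E1 E2 n; apply/andP; split.
    rewrite mulrC ler_pdivrMr ?exprn_gt0// mulrC.
    exact: (eigenvalue_comparison phi2_L2 cont2 phi2_gt0 phi1_L2 cont1 phi1_gt0
      c_gt0 phi21 n C2 E2 E1).
  exact: (eigenvalue_comparison phi1_L2 cont1 phi1_gt0 phi2_L2 cont2 phi2_gt0
    c_gt0 phi12 n C1 E1 E2).
Qed.
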